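(* Let $\sigma\in\mathcal{W}_{2,ac}(\mathbb{R}^n)$, $\mu\in\mathcal{W}_2(\mathbb{R}^n)$ and $P=[\theta_1,\ldots,\theta_n]\in O(n)$. Let $\phi$ be the convex potential given by Brenier's theorem, so that $\nabla\phi=T_\sigma^\mu$. Assume that (i) $\phi$ is differentiable at $E(\sigma)$; and (ii) there exist $x$ in the support of $\sigma$ and $r>0$ such that for every $\lambda\in(0,1)$ and every $y$ in the ball $B(x,r)$, $$\phi\big((1-\lambda)y+\lambda E(\sigma)\big)<(1-\lambda)\phi(y)+\lambda\phi(E(\sigma)).$$ For $\eta\in\{\mu,\mathcal{U}(\sigma,\mu,P)\}$ let $S^{\sigma,\eta,W_2}:=\operatorname*{arg\,min}_{S\in\mathcal{S}}W_2(S_\sharp\sigma,\eta)$, where $\mathcal{S}=\{x\mapsto ax+b\mid a>0,\ b\in\mathbb{R}^n\}$. Then $S^{\sigma,\mu,W_2}$ and $S^{\sigma,\mathcal{U}(\sigma,\mu,P),W_2}$ exist and are unique, and $$W_2\big((S^{\sigma,\mu,W_2})_\sharp\sigma,(S^{\sigma,\mathcal{U}(\sigma,\mu,P),W_2})_\sharp\sigma\big)=\big\|S^{\sigma,\mu,W_2}-S^{\sigma,\mathcal{U}(\sigma,\mu,P),W_2}\big\|_\sigma=\frac{W_2^2(\sigma,\mu)-\sum_{i=1}^nW_2^2(\sigma^{\theta_i},\mu^{\theta_i})}{2\sqrt{M_2(\sigma)-\|E(\sigma)\|^2}}.$$ In particular, $S^{\sigma,\mu,W_2}=S^{\sigma,\mathcal{U}(\sigma,\mu,P),W_2}$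 if and only if $W_2^2(\sigma,\mu)=\sum_{i=1}^nW_2^2(\sigma^{\theta_i},\mu^{\theta_i})$. Moreover, $$E\big((S^{\sigma,\mu,W_2})_\sharp\sigma\big)=E\big((S^{\sigma,\mathcal{U}(\sigma,\mu,P),W_2})_\sharp\sigma\big)=E(\mu).$$
   Context: $\mathcal{W}_2(\mathbb{R}^n)$ is the set of Borel probability measures on $\mathbb{R}^n$ with finite second moment $M_2(\sigma)=\int\|x\|^2d\sigma(x)$, and $\mathcal{W}_{2,ac}(\mathbb{R}^n)$ the subset of those absolutely continuous with respect to Lebesgue measure. $E(\sigma)=\int x\,d\sigma(x)$. $\sharp$ denotes pushforward. $W_2(\alpha,\beta)=\inf_\pi(\int\|x-y\|^2d\pi(x,y))^{1/2}$ over couplings $\pi$ of $\alpha,\beta$ (the same symbol is used for measures on $\mathbb{R}^n$ and on $\mathbb{R}$). $\|F\|_\sigma=(\int\|F(x)\|^2d\sigma(x))^{1/2}$. $T_\sigma^\mu$ is the optimal transport map from $\sigma$ to $\mu$ (the $\sigma$-a.e. unique gradient of a convex function pushing $\sigma$ to $\mu$). For $\theta\in S^{n-1}$, $\sigma^\theta$ is the pushforward of $\sigma$ under $x\mapsto x\cdot\theta$. For one-dimensional measures $\alpha$ (absolutely continuous) and $\beta$, $T_\alpha^\beta=F_\beta^{-1}\circ F_\alpha$ is the optimal transport map ($F_\alpha$ the cumulative distribution function, $F_\beta^{-1}$ the quantile function). For $P=[\theta_1,\ldots,\theta_n]\in O(n)$ (orthogonal matrix with columns $\theta_i$), $T_{\sigma,\mu;P}(x)=\sum_{i=1}^nT_{\sigma^{\theta_i}}^{\mu^{\theta_i}}(x\cdot\theta_i)\,\theta_i$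 and $\mathcal{U}(\sigma,\mu,P)=(T_{\sigma,\mu;P})_\sharp\sigma$. *)

(* Defs.v *)
From HB Require Import structures.
From mathcomp Require Import all_boot all_order all_algebra.
From mathcomp Require Import all_classical all_reals all_analysis.

Set Implicit Arguments.
Unset Strict Implicit.
Unset Printing Implicit Defensive.

Import Order.TTheory GRing.Theory Num.Theory.
Import numFieldNormedType.Exports.

Local Open Scope classical_set_scope.
Local Open Scope ring_scope.

(* Borel sigma-algebra on matrices, hence on R^n = 'rV[R]_n. *)
HB.instance Definition _ (R : realType) (m n : nat) :=
  @isMeasurable.Build (sigma_display (@open 'M[R]_(m, n))) 'M[R]_(m, n)
    <<s open >> (@sigma_algebra0 _ setT open) (@sigma_algebraC _ open)
    (@sigma_algebra_bigcup _ setT open).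

Section Euclidean.
Context {R : realType} {n : nat}.
Implicit Types (x y : 'rV[R]_n).

Definition dotv x y : R := \sum_(i < n) x 0 i * y 0 i.

(* The library's `|x| on 'rV[R]_n is the sup norm (same topology). *)
Definition enorm x : R := Num.sqrt (dotv x x).

Definition eball x (r : R) : set 'rV[R]_n := [set y | enorm (y - x) < r].

End Euclidean.

(* Measures are passed to the functionals below as bare set functions, so that
   they apply to [pushforward mu f] without a proof that [f] is measurable. *)

Section Wasserstein.
Context {R : realType} {d : measure_display} {T : measurableType d}.
Implicit Types (alpha beta : set T -> \bar R).

Definition coupling alpha beta : set (probability (T * T)%type R) :=
  [set p | forall A, measurable A ->
     pushforward p fst A = alpha A /\ pushforward p snd A = beta A].

Definition wasserstein2 (dist : T -> T -> R) alpha beta : \bar R :=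
  ereal_inf [set sqrte (\int[p]_z (dist z.1 z.2 ^+ 2)%:E)%E
            | p in coupling alpha beta].

End Wasserstein.

Definition W2 {R : realType} {n : nat} (alpha beta : set 'rV[R]_n -> \bar R) :=
  wasserstein2 (fun x y : 'rV[R]_n => enorm (x - y)) alpha beta.

Definition W2_1d {R : realType} (alpha beta : set R -> \bar R) :=
  wasserstein2 (fun x y : R => `|x - y|) alpha beta.

(* n-fold product of the one-dimensional Lebesgue measure, with R^(n+1)
   identified with R * R^n. *)
Fixpoint lebesgue_rV (R : realType) (n : nat) : set 'rV[R]_n -> \bar R :=
  match n return set 'rV[R]_n -> \bar R with
  | 0 => \d_(0 : 'rV[R]_0)
  | k.+1 => pushforward (lebesgue_measure \x @lebesgue_rV R k)%E
      (fun p : R * 'rV[R]_k => row_mx (p.1%:M : 'rV[R]_1) p.2 : 'rV[R]_k.+1)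
  end.

Section Moments.
Context {R : realType} {n : nat}.
Implicit Types (sigma : set 'rV[R]_n -> \bar R).

Definition moment2 sigma : \bar R := (\int[sigma]_x (enorm x ^+ 2)%:E)%E.

Definition mean sigma : 'rV[R]_n :=
  \row_i fine (\int[sigma]_x (x 0 i)%:E)%E.

Definition L2norm sigma (F : 'rV[R]_n -> 'rV[R]_n) : \bar R :=
  sqrte (\int[sigma]_x (enorm (F x) ^+ 2)%:E)%E.

Definition msupport sigma : set 'rV[R]_n :=
  [set x | forall U, open_nbhs x U -> (0 < sigma U)%E].

End Moments.

Definition W2_space {R : realType} {n : nat} : set (probability 'rV[R]_n R) :=
  [set sigma | (moment2 sigma < +oo)%E].

Definition W2_space_ac {R : realType} {n : nat} :
    set (probability 'rV[R]_n R) :=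
  [set sigma | W2_space sigma /\ sigma `<< @lebesgue_rV R n].

Section ConvexPotential.
Context {R : realType} {n : nat}.
Implicit Types (phi : 'rV[R]_n -> \bar R) (x y v g : 'rV[R]_n).

(* Potentials take values in R \cup {+oo}, as in Brenier's theorem. *)
Definition convex_ereal phi : Prop :=
  (forall x, phi x != -oo%E) /\
  forall x y (t : R), 0 < t < 1 ->
    (phi ((1 - t) *: x + t *: y)%R <= (1 - t)%:E * phi x + t%:E * phi y)%E.

Definition differentiable_ereal phi x : Prop :=
  (\forall y \near x, phi y \is a fin_num) /\ differentiable (fine \o phi) x.

Definition has_gradient phi x g : Prop :=
  differentiable_ereal phi x /\ forall v, 'd (fine \o phi) x v = dotv g v.

End ConvexPotential.

Definition optimal_transport_map {R : realType} {n : nat}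
    (sigma mu : set 'rV[R]_n -> \bar R) (T : 'rV[R]_n -> 'rV[R]_n) : Prop :=
  [/\ measurable_fun setT T,
      forall A, measurable A -> pushforward sigma T A = mu A
    & L2norm sigma (fun x => x - T x) = W2 sigma mu].

Section OneDimensional.
Context {R : realType}.
Implicit Types (alpha beta : set R -> \bar R).

Definition cdf_of alpha (t : R) : R := fine (alpha `]-oo, t]%classic).

(* On ]0, 1[ this is the usual quantile function; [inf] is 0 on sets that are
   empty or unbounded below, which only matters for u = 0 and u = 1. *)
Definition quantile beta (u : R) : R := inf [set t | u <= cdf_of beta t].

Definition transport_map_1d alpha beta (t : R) : R :=
  quantile beta (cdf_of alpha t).

End OneDimensional.

Section Slices.
Context {R : realType} {n : nat}.
Implicit Types (sigma mu : set 'rV[R]_n -> \bar R) (P : 'M[R]_n).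

Definition slice sigma (theta : 'rV[R]_n) : set R -> \bar R :=
  pushforward sigma (fun x => dotv x theta).

(* i-th column of P, as an element of 'rV[R]_n. *)
Definition theta P (i : 'I_n) : 'rV[R]_n := (col i P)^T.

Definition orthogonal_mx P : Prop := P^T *m P = 1%:M.

Definition slice_map sigma mu P (x : 'rV[R]_n) : 'rV[R]_n :=
  \sum_(i < n)
    transport_map_1d (slice sigma (theta P i)) (slice mu (theta P i))
      (dotv x (theta P i)) *: theta P i.

Definition slice_push sigma mu P : set 'rV[R]_n -> \bar R :=
  pushforward sigma (slice_map sigma mu P).

End Slices.

Definition argmin {R : realType} {T : Type} (D : set T) (f : T -> \bar R) :
    set T :=
  [set x | D x /\ forall y, D y -> (f x <= f y)%E].

Definition scal_trans {R : realType} {n : nat} :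
    set ('rV[R]_n -> 'rV[R]_n) :=
  [set S | exists a b, 0 < a /\ S = (fun x => a *: x + b)].

Definition best_scal_trans {R : realType} {n : nat}
    (sigma eta : set 'rV[R]_n -> \bar R) : set ('rV[R]_n -> 'rV[R]_n) :=
  argmin scal_trans (fun S => W2 (pushforward sigma S) eta).

(* Main.v *)
Require Import Defs.
From HB Require Import structures.
From mathcomp Require Import all_boot all_order all_algebra.
From mathcomp Require Import all_classical all_reals all_analysis.
From mathcomp Require Import measurable_realfun.
From mathcomp Require Import ring lra.
Set Implicit Arguments.
Unset Strict Implicit.
Unset Printing Implicit Defensive.
Import Order.TTheory GRing.Theory Num.Theory.
Import numFieldNormedType.Exports.
Local Open Scope classical_set_scope.
Local Open Scope ring_scope.

(* For [S x = a *: x + b] with [a > 0], the couplings of [S # sigma] and [eta]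
   are those of [sigma] and [eta] up to an affine change of the first variable.
   Hence [W2^2 (S # sigma, eta)] is an explicit quadratic in [(a, b)] whose only
   non-trivial coefficient is [C eta], the largest value of [E (x . y)] over the
   couplings of [sigma] and [eta]. It is minimal for
   [a = (C eta - E sigma . E eta) / V] and [b = E eta - a *: E sigma], with [V]
   the variance of [sigma], as soon as this [a] is positive. For [eta = mu],
   positivity is the strict monotonicity of the gradient of [phi] between the
   mean of [sigma] and the given ball. For [eta = U], Pythagoras in the basis
   [theta P] together with the optimality of the quantile maps on the slices
   (where absolute continuity is used: hyperplanes are null) shows that
   [slice_map] is optimal and that [C U] is a sum of one-dimensional maxima, so
   [C U >= C mu]. The stated formula is then [(C U - C mu) / sqrt V] rewritten
   with [W2^2 = M_2 sigma + M_2 eta - 2 C eta]. *)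

(** * Borel sets of row vectors *)

Lemma measurable_coord (R : realType) (n : nat) (i : 'I_n) :
  measurable_fun [set: 'rV[R]_n] (fun x : 'rV[R]_n => x 0 i : R).
Proof.
apply: (measurability _ (RGenOInfty.measurableE R)) => _ [_ [a ->] <-].
rewrite setTI; apply: sub_sigma_algebra.
apply: open_comp => [x _|]; first exact: coord_continuous.
exact: interval_open.
Qed.

(** Every open set is a countable union of sup-norm boxes with rational centre and radius
    [k.+1%:R^-1], and the preimage of a box is a finite intersection of conditions on the
    coordinates. *)
Lemma measurable_rV d (T : measurableType d) (R : realType) (n : nat)
    (f : T -> 'rV[R]_n) :
  (forall i, measurable_fun setT (fun t => f t 0 i)) -> measurable_fun setT f.
Proof.
move=> mf.
apply: (measurability (@open 'rV[R]_n)) => // _ [U oU <-]; rewrite setTI.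
pose box (qk : 'rV[rat]_n * nat) : set 'rV[R]_n :=
  [set y | forall i, `|y 0 i - ratr (qk.1 0 i)| < qk.2.+1%:R^-1].
have Ubox : U = \bigcup_qk (if `[< box qk `<=` U >] then box qk else set0).
  apply/seteqP; split => [y Uy|y [qk _]]; last first.
    by case: ifPn => // /asboolP; exact.
  have /nbhs_ballP[e /= e0 yU] := oU y Uy.
  (* Both [y] and any point of the box will be within [k.+1%:R^-1] of the centre [q], hence within
     [e] of each other. *)
  pose k := Num.truncn (2 / e).
  have ke : k.+1%:R^-1 < e / 2.
    by rewrite invf_plt ?posrE ?divr_gt0// invf_div truncnS_gt.
  have /choice[q qP] (i : 'I_n) : exists q : rat, `|y 0 i - ratr q| < k.+1%:R^-1.
    have [//|q] := @rat_in_itvoo R (y 0 i) (y 0 i + k.+1%:R^-1).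
      by rewrite ltrDl.
    rewrite in_itv/= => /andP[h1 h2]; exists q.
    by rewrite ltr_norml; move: _^-1 h1 h2 => dl h1 h2; apply/andP; split; lra.
  exists (\row_i q i, k) => //; rewrite ifT.
    by move=> i /=; rewrite mxE.
  apply/asboolP => z /= zq; apply: yU; split => // i j; rewrite ord1 /ball/=.
  have := zq j; have := qP j; rewrite mxE.
  rewrite !ltr_norml; move: _^-1 ke => dl ke /andP[? ?] /andP[? ?].
  by apply/andP; split; lra.
rewrite Ubox preimage_bigcup.
apply: countable_bigcupT_measurable => [|qk]; first exact: countableP.
case: ifPn => _; last by rewrite preimage_set0.
rewrite (_ : _ @^-1` _ = \bigcap_(i in [set: 'I_n])
    (fun t => f t 0 i) @^-1` [set u | `|u - ratr (qk.1 0 i)| < qk.2.+1%:R^-1]).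
  apply: fin_bigcap_measurable => // i _.
  rewrite -[X in measurable X]setTI; apply: mf => //.
  rewrite (_ : mkset _ = `]ratr (qk.1 0 i) - qk.2.+1%:R^-1,
      ratr (qk.1 0 i) + qk.2.+1%:R^-1[%classic)//.
  by apply/seteqP; split => u /=; rewrite in_itv/= ltr_distl.
by apply/seteqP; split => t /= h i; [move=> _|]; exact: h.
Qed.

(** * Inner product and orthonormal bases *)

Section DotProduct.
Context {R : realType} {n : nat}.
Implicit Types x y z : 'rV[R]_n.

Lemma dotvC x y : dotv x y = dotv y x.
Proof. by apply: eq_bigr => i _; rewrite mulrC. Qed.

Lemma dotvDl x y z : dotv (x + y) z = dotv x z + dotv y z.
Proof. by rewrite -big_split; apply: eq_bigr => i _; rewrite mxE mulrDl. Qed.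

Lemma dotvZl (a : R) x y : dotv (a *: x) y = a * dotv x y.
Proof. by rewrite mulr_sumr; apply: eq_bigr => i _; rewrite mxE mulrA. Qed.

Lemma dotvNl x y : dotv (- x) y = - dotv x y.
Proof. by rewrite -scaleN1r dotvZl mulN1r. Qed.

Lemma dotvDr x y z : dotv z (x + y) = dotv z x + dotv z y.
Proof. by rewrite dotvC dotvDl !(dotvC z). Qed.

Lemma dotvZr (a : R) x y : dotv y (a *: x) = a * dotv y x.
Proof. by rewrite dotvC dotvZl dotvC. Qed.

Lemma dotvNr x y : dotv y (- x) = - dotv y x.
Proof. by rewrite dotvC dotvNl dotvC. Qed.

Lemma dotv0l x : dotv 0 x = 0.
Proof. by rewrite -[0](scale0r (0 : 'rV[R]_n)) dotvZl mul0r. Qed.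

Lemma dotv_ge0 x : 0 <= dotv x x.
Proof. by apply: sumr_ge0 => i _; exact: sqr_ge0. Qed.

Lemma dotv_eq0 x : dotv x x = 0 -> x = 0.
Proof.
move=> /eqP; rewrite psumr_eq0 => [/allP h|i _]; last exact: sqr_ge0.
apply/rowP => i; rewrite mxE; apply/eqP; rewrite -sqrf_eq0 expr2.
by apply: h; rewrite mem_index_enum.
Qed.

Lemma enorm_sqr x : enorm x ^+ 2 = dotv x x.
Proof. by rewrite sqr_sqrtr// dotv_ge0. Qed.

Lemma dotv_sum_r (I : finType) x (F : I -> 'rV[R]_n) :
  dotv x (\sum_i F i) = \sum_i dotv x (F i).
Proof.
elim/big_rec2: _ => [|i u v _ <-]; first by rewrite dotvC dotv0l.
by rewrite dotvDr.
Qed.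

End DotProduct.

Section OrthogonalColumns.
Context {R : realType} {n : nat} (P : 'M[R]_n).
Hypothesis oP : orthogonal_mx P.

Lemma dotv_theta i j : dotv (theta P i) (theta P j) = (i == j)%:R.
Proof.
move: oP => /matrixP/(_ i j); rewrite !mxE => <-.
by apply: eq_bigr => k _; rewrite !mxE.
Qed.

(** As [P] is square, [P^T *m P = 1%:M] also gives [P *m P^T = 1%:M]; the coordinates of [x] in the
    basis [theta P] are the entries of [x *m P]. *)
Lemma dotv_parseval x y :
  dotv x y = \sum_i dotv x (theta P i) * dotv y (theta P i).
Proof.
have oP' : P *m P^T = 1%:M by apply: mulmx1C.
have E z i : dotv z (theta P i) = (z *m P) 0 i.
  by rewrite mxE; apply: eq_bigr => k _; rewrite !mxE.
have D (u v : 'rV[R]_n) : dotv u v = (u *m v^T) 0 0.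
  by rewrite mxE; apply: eq_bigr => k _; rewrite mxE.
transitivity (dotv (x *m P) (y *m P)).
  by rewrite !D trmx_mul mulmxA -(mulmxA x) oP' mulmx1.
by apply: eq_bigr => i _; rewrite !E.
Qed.

Lemma theta_neq0 i : theta P i != 0.
Proof.
apply/eqP => t0; have := dotv_theta i i; rewrite t0 dotv0l eqxx => /esym/eqP.
by rewrite oner_eq0.
Qed.

Lemma dotv_sum_theta (c : 'I_n -> R) i :
  dotv (\sum_j c j *: theta P j) (theta P i) = c i.
Proof.
rewrite dotvC dotv_sum_r (bigD1 i)//= big1 ?addr0 => [|j ji].
  by rewrite dotvZr dotv_theta eqxx mulr1.
by rewrite dotvZr dotv_theta eq_sym (negbTE ji) mulr0.
Qed.

End OrthogonalColumns.

(** * Square-integrable random vectors *)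

Section SquareIntegrable.
Context {R : realType} {d : measure_display} {T : measurableType d}.
Variable P : probability T R.
Implicit Types f g : T -> R.

Definition sq_integrable f :=
  measurable_fun setT f /\ (\int[P]_x (f x ^+ 2)%:E < +oo)%E.

Lemma measurable_sqr_EFin f :
  measurable_fun setT f -> measurable_fun setT (fun x => (f x ^+ 2)%:E).
Proof. by move=> mf; apply/measurable_EFinP; exact: measurable_funX. Qed.

Lemma integrable_sqr f :
  sq_integrable f -> P.-integrable setT (EFin \o (fun x => f x ^+ 2)).
Proof.
move=> [mf foo]; apply/integrableP; split; first exact: measurable_sqr_EFin.
by under eq_integral => x _ do rewrite /= ger0_norm ?sqr_ge0//.
Qed.

Lemma sq_integrable_dom f g h :
  measurable_fun setT f -> sq_integrable g -> sq_integrable h ->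
  (forall x, f x ^+ 2 <= 2 * g x ^+ 2 + 2 * h x ^+ 2) -> sq_integrable f.
Proof.
move=> mf sg sh fgh; split => //.
have ig : P.-integrable setT
    (EFin \o (fun x => 2 * g x ^+ 2 + 2 * h x ^+ 2)).
  apply: (@integrableD _ _ _ P _ measurableT
    (EFin \o (fun x => 2 * g x ^+ 2)) (EFin \o (fun x => 2 * h x ^+ 2))).
    exact: (integrableZl measurableT 2 (integrable_sqr sg)).
  exact: (integrableZl measurableT 2 (integrable_sqr sh)).
have /integrableP[_] := ig.
apply: le_lt_trans; apply: ge0_le_integral => //.
- by move=> x _; rewrite lee_fin sqr_ge0.
- exact: measurable_sqr_EFin.
- by apply: measurableT_comp => //; exact: (measurable_int P).
- move=> x _; rewrite lee_fin (le_trans (fgh x))//; exact: ler_norm.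
Qed.

Lemma sq_integrableD f g :
  sq_integrable f -> sq_integrable g -> sq_integrable (fun x => f x + g x).
Proof.
move=> sf sg; apply: (sq_integrable_dom _ sf sg).
  by apply: measurable_funD; [exact: sf.1|exact: sg.1].
by move=> x; have := sqr_ge0 (f x - g x); nra.
Qed.

Lemma sq_integrableZ (a : R) f :
  sq_integrable f -> sq_integrable (fun x => a * f x).
Proof.
move=> sf; split; first by apply: measurable_funM => //; exact: sf.1.
under eq_integral => x _ do rewrite exprMn EFinM.
rewrite ge0_integralZl//; last 3 first.
- exact: measurable_sqr_EFin sf.1.
- by move=> x _; rewrite lee_fin sqr_ge0.
- by rewrite lee_fin sqr_ge0.
by rewrite lte_mul_pinfty ?lee_fin ?sqr_ge0//; exact: sf.2.
Qed.

Lemma sq_integrable_cst (c : R) : sq_integrable (fun=> c).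
Proof.
split => //; rewrite integral_cst//=.
by rewrite probability_setT mule1 ltry.
Qed.

Lemma sq_integrable_sum (I : finType) (F : I -> T -> R) :
  (forall i, sq_integrable (F i)) -> sq_integrable (fun x => \sum_i F i x).
Proof.
move=> sF.
suff h (s : seq I) : sq_integrable (fun x => \sum_(i <- s) F i x) by exact: h.
elim: s => [|i s ih].
  under eq_fun do rewrite big_nil.
  exact: sq_integrable_cst.
under eq_fun do rewrite big_cons.
exact: sq_integrableD.
Qed.

(** Domination by [f ^+ 2 + g ^+ 2], from the non-negativity of the squares of [f + g] and
    [f - g]. *)
Lemma integrable_mul f g : sq_integrable f -> sq_integrable g ->
  P.-integrable setT (EFin \o (fun x => f x * g x)).
Proof.
move=> sf sg.
have mfg : measurable_fun setT (fun x => f x * g x).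
  by apply: measurable_funM; [exact: sf.1|exact: sg.1].
apply: (@le_integrable _ _ _ P _ measurableT _
    (EFin \o (fun x => f x ^+ 2 + g x ^+ 2))).
- exact/measurable_EFinP.
- move=> x _ /=; rewrite lee_fin [leRHS]ger0_norm ?addr_ge0 ?sqr_ge0//.
  rewrite ler_norml; have := sqr_ge0 (f x - g x); have := sqr_ge0 (f x + g x).
  by move=> h1 h2; apply/andP; split; nra.
- apply: (@integrableD _ _ _ P _ measurableT
    (EFin \o (fun x => f x ^+ 2)) (EFin \o (fun x => g x ^+ 2))).
    exact: integrable_sqr.
  exact: integrable_sqr.
Qed.

Lemma sq_integrable_integrable f :
  sq_integrable f -> P.-integrable setT (EFin \o f).
Proof.
move=> sf; have := integrable_mul sf (sq_integrable_cst 1).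
by apply: eq_integrable => // x _ /=; rewrite mulr1.
Qed.

End SquareIntegrable.

Section VectorL2.
Context {R : realType} {d : measure_display} {T : measurableType d} {n : nat}.
Variable P : probability T R.
Implicit Types X Y Z : T -> 'rV[R]_n.

Definition sq_integrable_rV X := forall i, sq_integrable P (fun w => X w 0 i).

(** The inner product of square-integrable random vectors. [Rintegral] is the [fine] of an extended
    integral, hence the hypotheses [sq_integrable_rV] in the linearity rules. *)
Definition corr X Y : R := (\int[P]_w dotv (X w) (Y w))%R.

Definition expect X : 'rV[R]_n := \row_i (\int[P]_w (X w 0 i))%R.

Lemma sq_integrable_rVD X Y : sq_integrable_rV X -> sq_integrable_rV Y ->
  sq_integrable_rV (fun w => X w + Y w).
Proof.
by move=> sX sY i; under eq_fun do rewrite mxE; exact: sq_integrableD.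
Qed.

Lemma sq_integrable_rVZ (a : R) X :
  sq_integrable_rV X -> sq_integrable_rV (fun w => a *: X w).
Proof. by move=> sX i; under eq_fun do rewrite mxE; exact: sq_integrableZ. Qed.

Lemma sq_integrable_rV_cst (c : 'rV[R]_n) : sq_integrable_rV (fun=> c).
Proof. by move=> i; exact: sq_integrable_cst. Qed.

Lemma sq_integrable_rVB X Y : sq_integrable_rV X -> sq_integrable_rV Y ->
  sq_integrable_rV (fun w => X w - Y w).
Proof.
move=> sX sY; under eq_fun do rewrite -scaleN1r.
by apply: sq_integrable_rVD => //; exact: sq_integrable_rVZ.
Qed.

Lemma sq_integrable_dotv X (c : 'rV[R]_n) :
  sq_integrable_rV X -> sq_integrable P (fun w => dotv (X w) c).
Proof.
move=> sX; rewrite /dotv; apply: sq_integrable_sum => i.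
by under eq_fun do rewrite mulrC; exact: sq_integrableZ.
Qed.

Lemma integrable_dotv X Y : sq_integrable_rV X -> sq_integrable_rV Y ->
  P.-integrable setT (EFin \o (fun w => dotv (X w) (Y w))).
Proof.
move=> sX sY; rewrite /dotv.
suff h (s : seq 'I_n) : P.-integrable setT
    (EFin \o (fun w => \sum_(i <- s) X w 0 i * Y w 0 i)) by exact: h.
elim: s => [|i s ih].
  under [X in EFin \o X]eq_fun do rewrite big_nil.
  exact: finite_measure_integrable_cst.
under [X in EFin \o X]eq_fun do rewrite big_cons.
exact: (integrableD measurableT (integrable_mul (sX i) (sY i)) ih).
Qed.

Lemma corrC X Y : corr X Y = corr Y X.
Proof. by apply: eq_Rintegral => w _; rewrite dotvC. Qed.

Lemma corrDl X Y Z : sq_integrable_rV X -> sq_integrable_rV Y ->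
  sq_integrable_rV Z -> corr (fun w => X w + Y w) Z = corr X Z + corr Y Z.
Proof.
move=> sX sY sZ; rewrite -RintegralD//; last 2 first.
- exact: integrable_dotv.
- exact: integrable_dotv.
by apply: eq_Rintegral => w _; rewrite dotvDl.
Qed.

Lemma corrZl (a : R) X Y : sq_integrable_rV X -> sq_integrable_rV Y ->
  corr (fun w => a *: X w) Y = a * corr X Y.
Proof.
move=> sX sY; rewrite -RintegralZl//; last exact: integrable_dotv.
by apply: eq_Rintegral => w _; rewrite dotvZl.
Qed.

Lemma corrBl X Y Z : sq_integrable_rV X -> sq_integrable_rV Y ->
  sq_integrable_rV Z -> corr (fun w => X w - Y w) Z = corr X Z - corr Y Z.
Proof.
move=> sX sY sZ; rewrite -mulN1r -corrZl// -corrDl//.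
  by apply: eq_Rintegral => w _; rewrite scaleN1r.
exact: sq_integrable_rVZ.
Qed.

Lemma expect_cst (c : 'rV[R]_n) : expect (fun=> c) = c.
Proof.
by apply/rowP => i; rewrite !mxE Rintegral_cst//= probability_setT mulr1.
Qed.

Lemma corr_cst (c : 'rV[R]_n) X : sq_integrable_rV X ->
  corr (fun=> c) X = dotv c (expect X).
Proof.
move=> sX; rewrite /corr /dotv.
(* Integrability and value are proved together: additivity at each step needs the integrability of
   the remaining sum. *)
have h (s : seq 'I_n) : P.-integrable setT
    (EFin \o (fun w => \sum_(i <- s) c 0 i * X w 0 i)) /\
  (\int[P]_w (\sum_(i <- s) c 0 i * X w 0 i))%R =
  \sum_(i <- s) c 0 i * (\int[P]_w X w 0 i)%R.
  elim: s => [|i s [ih1 ih2]].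
    under [X in EFin \o X]eq_fun do rewrite big_nil.
    split; first exact: finite_measure_integrable_cst.
    under eq_Rintegral do rewrite big_nil.
    by rewrite big_nil Rintegral_cst// mul0r.
  have ii : P.-integrable setT (EFin \o (fun w => X w 0 i)).
    exact: sq_integrable_integrable.
  have ic : P.-integrable setT (EFin \o (fun w => c 0 i * X w 0 i)).
    exact: sq_integrable_integrable (sq_integrableZ _ (sX i)).
  under [X in EFin \o X]eq_fun do rewrite big_cons.
  split; first exact: (integrableD measurableT ic ih1).
  under eq_Rintegral do rewrite big_cons.
  by rewrite RintegralD// ih2 big_cons RintegralZl.
by rewrite (h _).2; apply: eq_bigr => i _; rewrite mxE.
Qed.

Lemma corr_ge0 X : 0 <= corr X X.
Proof. by apply: Rintegral_ge0 => w _; exact: dotv_ge0. Qed.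

Lemma integral_enorm_sqr X : sq_integrable_rV X ->
  (\int[P]_w (enorm (X w) ^+ 2)%:E)%E = (corr X X)%:E.
Proof.
move=> sX; rewrite /corr /Rintegral fineK.
  by apply: eq_integral => w _; rewrite enorm_sqr.
exact: integrable_fin_num (integrable_dotv sX sX).
Qed.

Lemma sq_integrable_rVP X : measurable_fun setT X ->
  (\int[P]_w (enorm (X w) ^+ 2)%:E < +oo)%E -> sq_integrable_rV X.
Proof.
move=> mX Xoo i; split.
  exact: (measurableT_comp (@measurable_coord R n i) mX).
apply: le_lt_trans Xoo; apply: ge0_le_integral => //.
- by move=> w _; rewrite lee_fin sqr_ge0.
- apply: measurable_sqr_EFin.
  exact: (measurableT_comp (@measurable_coord R n i) mX).
- apply/measurable_EFinP; under eq_fun do rewrite enorm_sqr.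
  rewrite /dotv; apply: measurable_sum => j; apply: measurable_funM;
  exact: (measurableT_comp (@measurable_coord R n j) mX).
- move=> w _; rewrite lee_fin enorm_sqr /dotv (bigD1 i)//= -expr2 lerDl.
  by apply: sumr_ge0 => j _; exact: sqr_ge0.
Qed.

End VectorL2.

(** * Equality in law and couplings *)

Section SameLaw.
Context {R : realType} {d1 d2 d : measure_display}.
Context {T1 : measurableType d1} {T2 : measurableType d2}.
Context {T : measurableType d}.
Variables (P : probability T1 R) (Q : probability T2 R).

(** The two variables may live on different spaces: a coupling with its projections and [sigma] with
    a transport map are thus compared directly as random vectors. *)
Definition same_law (X : T1 -> T) (Y : T2 -> T) : Prop :=
  forall A, measurable A -> P (X @^-1` A) = Q (Y @^-1` A).

Variables (X : T1 -> T) (Y : T2 -> T).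
Hypotheses (mX : measurable_fun setT X) (mY : measurable_fun setT Y).
Hypothesis XY : same_law X Y.

Let mXm := isMeasurableFun.Build _ _ _ _ X mX.
Let mYm := isMeasurableFun.Build _ _ _ _ Y mY.
Let X' : {mfun T1 >-> T} := HB.pack X mXm.
Let Y' : {mfun T2 >-> T} := HB.pack Y mYm.

Lemma ge0_integral_same_law (f : T -> \bar R) : measurable_fun setT f ->
  (forall x, 0 <= f x)%E -> (\int[P]_w f (X w) = \int[Q]_w f (Y w))%E.
Proof.
move=> mf f0.
transitivity (\int[distribution P X']_y f y)%E.
  by rewrite ge0_integral_distribution.
transitivity (\int[distribution Q Y']_y f y)%E; last first.
  by rewrite ge0_integral_distribution.
by apply: eq_measure_integral => A mA _; exact: XY.
Qed.

Lemma integrable_same_law (f : T -> R) : measurable_fun setT f ->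
  P.-integrable setT (EFin \o (f \o X)) -> Q.-integrable setT (EFin \o (f \o Y)).
Proof.
move=> mf /integrableP[_ iX]; apply/integrableP; split.
  by apply/measurable_EFinP; exact: measurableT_comp.
move: iX; rewrite (@ge0_integral_same_law (fun x => `|(f x)%:E|%E))//.
by apply: measurableT_comp => //; exact/measurable_EFinP.
Qed.

Lemma Rintegral_same_law (f : T -> R) : measurable_fun setT f ->
  P.-integrable setT (EFin \o (f \o X)) ->
  (\int[P]_w f (X w))%R = (\int[Q]_w f (Y w))%R.
Proof.
move=> mf iX; have iY := integrable_same_law mf iX.
have mfE : measurable_fun setT (EFin \o f) by exact/measurable_EFinP.
congr fine.
transitivity (\int[distribution P X']_y (f y)%:E)%E.
  by rewrite integral_distribution.
transitivity (\int[distribution Q Y']_y (f y)%:E)%E; last first.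
  by rewrite integral_distribution.
by apply: eq_measure_integral => A mA _; exact: XY.
Qed.

End SameLaw.

Section SameLawTheory.
Context {R : realType} {d1 d2 d3 d d' : measure_display}.
Context {T1 : measurableType d1} {T2 : measurableType d2}.
Context {T3 : measurableType d3}.
Context {T : measurableType d} {T' : measurableType d'}.
Variables (P : probability T1 R) (Q : probability T2 R).
Variables (Q' : probability T3 R).

Lemma same_law_sym (X : T1 -> T) (Y : T2 -> T) :
  same_law P Q X Y -> same_law Q P Y X.
Proof. by move=> XY A mA; rewrite XY. Qed.

Lemma same_law_trans (X : T1 -> T) (Y : T2 -> T) (Z : T3 -> T) :
  same_law P Q X Y -> same_law Q Q' Y Z -> same_law P Q' X Z.
Proof. by move=> XY YZ A mA; rewrite XY// YZ. Qed.

Lemma same_law_comp (X : T1 -> T) (Y : T2 -> T) (f : T -> T') :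
  measurable_fun setT f -> same_law P Q X Y -> same_law P Q (f \o X) (f \o Y).
Proof.
move=> mf XY A mA; apply: (XY (f @^-1` A)).
by rewrite -[X in measurable X]setTI; exact: mf.
Qed.

Lemma sq_integrable_same_law (X : T1 -> R) (Y : T2 -> R) :
  measurable_fun setT X -> measurable_fun setT Y -> same_law P Q X Y ->
  sq_integrable P X -> sq_integrable Q Y.
Proof.
move=> mX mY XY [_ sX]; split => //; move: sX.
rewrite (@ge0_integral_same_law _ _ _ _ _ _ _ P Q X Y mX mY XY
  (fun x => (x ^+ 2)%:E))//.
  exact: (measurable_sqr_EFin (@measurable_id _ _ setT)).
by move=> x; rewrite lee_fin sqr_ge0.
Qed.

End SameLawTheory.

Section SameLawVector.
Context {R : realType} {d1 d2 : measure_display} {n : nat}.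
Context {T1 : measurableType d1} {T2 : measurableType d2}.
Variables (P : probability T1 R) (Q : probability T2 R).
Variables (X : T1 -> 'rV[R]_n) (Y : T2 -> 'rV[R]_n).
Hypotheses (mX : measurable_fun setT X) (mY : measurable_fun setT Y).
Hypothesis XY : same_law P Q X Y.

Lemma measurable_dotv d (T : measurableType d) (U V : T -> 'rV[R]_n) :
  measurable_fun setT U -> measurable_fun setT V ->
  measurable_fun setT (fun w => dotv (U w) (V w)).
Proof.
move=> mU mV; apply: measurable_sum => i; apply: measurable_funM.
  exact: (measurableT_comp (@measurable_coord R n i) mU).
exact: (measurableT_comp (@measurable_coord R n i) mV).
Qed.

Lemma sq_integrable_rV_same_law : sq_integrable_rV P X -> sq_integrable_rV Q Y.
Proof.
move=> sX i.
apply: (sq_integrable_same_law _ _ (same_law_comp (@measurable_coord R n i) XY)).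
- exact: (measurableT_comp (@measurable_coord R n i) mX).
- exact: (measurableT_comp (@measurable_coord R n i) mY).
- exact: sX.
Qed.

Lemma corr_same_law : sq_integrable_rV P X -> corr P X X = corr Q Y Y.
Proof.
move=> sX.
have m : measurable_fun setT (fun x : 'rV[R]_n => dotv x x).
  exact: measurable_dotv.
exact: (Rintegral_same_law mX mY XY m (integrable_dotv sX sX)).
Qed.

Lemma expect_same_law : sq_integrable_rV P X -> expect P X = expect Q Y.
Proof.
move=> sX; apply/rowP => i; rewrite !mxE.
apply: (Rintegral_same_law mX mY XY (@measurable_coord R n i)).
exact: sq_integrable_integrable (sX i).
Qed.

End SameLawVector.

Section Coupling.
Context {R : realType} {d1 d : measure_display}.
Context {T1 : measurableType d1} {T : measurableType d}.
Variables (P : probability T1 R) (X Y : T1 -> T).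
Hypotheses (mX : measurable_fun setT X) (mY : measurable_fun setT Y).

(** The joint distribution of [X] and [Y] is a coupling, and its cost is the integral on the
    right. *)
Lemma wasserstein2_le (dist : T -> T -> R) (alpha beta : set T -> \bar R) :
  (forall A, measurable A -> P (X @^-1` A) = alpha A) ->
  (forall A, measurable A -> P (Y @^-1` A) = beta A) ->
  measurable_fun setT (fun z : T * T => dist z.1 z.2) ->
  (wasserstein2 dist alpha beta <=
    sqrte (\int[P]_w (dist (X w) (Y w) ^+ 2)%:E))%E.
Proof.
move=> Xa Yb md.
have mXY : measurable_fun setT (fun w => (X w, Y w)) by exact: measurable_fun_pair.
pose m := isMeasurableFun.Build _ _ _ _ (fun w => (X w, Y w)) mXY.
pose XY : {mfun T1 >-> (T * T)%type} := HB.pack (fun w => (X w, Y w)) m.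
apply: ereal_inf_lbound; exists (distribution P XY).
  by move=> A mA; split; [rewrite -Xa|rewrite -Yb].
congr sqrte; rewrite ge0_integral_distribution//.
  exact: measurable_sqr_EFin.
by move=> z; rewrite lee_fin sqr_ge0.
Qed.

End Coupling.

Lemma le_wasserstein2 (R : realType) d (T : measurableType d)
    (dist : T -> T -> R) (alpha beta : set T -> \bar R) (e : \bar R) :
  (0 <= e)%E ->
  (forall p, coupling alpha beta p ->
     (e <= \int[p]_z (dist z.1 z.2 ^+ 2)%:E)%E) ->
  (sqrte e <= wasserstein2 dist alpha beta)%E.
Proof.
move=> e0 h; apply/ereal_infP => _ [p /h ep <-].
by rewrite lee_sqrt// integral_ge0// => z _; rewrite lee_fin sqr_ge0.
Qed.

(** * Hyperplanes are Lebesgue-null *)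

Lemma lebesgue_rV_set0 (R : realType) (n : nat) : @lebesgue_rV R n set0 = 0%E.
Proof.
elim: n => [|n IHn] /=; first by rewrite /dirac indicE in_set0.
rewrite /pushforward preimage_set0 /product_measure1 integral0_eq// => x _ /=.
by rewrite xsection0.
Qed.

(* Arguing on arbitrary subsets avoids any measurability of the sections. *)
Lemma lebesgue_rV_hyperplane (R : realType) (n : nat) (t : 'rV[R]_n) (c : R)
    (B : set 'rV[R]_n) :
  t != 0 -> B `<=` [set x | dotv x t = c] -> lebesgue_rV B = 0%E.
Proof.
elim: n t c B => [t c B /eqP[]|n IHn t c B t0 BH]; first exact: thinmx0.
rewrite /= /pushforward /product_measure1.
pose u : 'rV[R]_1 := lsubmx (t : 'rV_(1 + n)).
pose v : 'rV[R]_n := rsubmx (t : 'rV_(1 + n)).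
have dE (s : R) (y : 'rV[R]_n) :
    dotv (row_mx (s%:M : 'rV[R]_1) y : 'rV[R]_n.+1) t = s * u 0 0 + dotv y v.
  rewrite /dotv (@big_split_ord _ _ _ 1 n)/= big_ord1.
  congr (_ + _); first congr (_ * _).
  - by apply: etrans (row_mxEl _ _ _ _) _; rewrite mxE eqxx mulr1n.
  - by rewrite mxE.
  - apply: eq_bigr => i _; congr (_ * _); first exact: row_mxEr.
    by rewrite mxE.
(* If [v] is non-zero, every section at a fixed first coordinate lies in a hyperplane of normal [v].
   Otherwise the set lies over the single point [c / u 0 0], which is null on the line. *)
have [v0|v0] := eqVneq v 0; last first.
  apply: integral0_eq => s _ /=.
  apply: (IHn v (c - s * u 0 0) _ v0) => y; rewrite /xsection/= inE => /BH/=.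
  by rewrite dE => <-; rewrite addrC addKr.
have u0 : u 0 0 != 0.
  apply: contra t0 => /eqP u00; apply/eqP.
  have u_0 : u = 0 by apply/rowP => i; rewrite ord1 u00 mxE.
  by apply: etrans (esym (hsubmxK (t : 'rV_(1 + n)))) _; rewrite -/u -/v u_0 v0 row_mx0.
set f := (X in (\int[_]_x X x)%E).
rewrite (_ : f = f \_ [set c / u 0 0]).
  by rewrite -integral_mkcond integral_set1.
apply/funext => s; rewrite patchE; case: ifPn => //.
rewrite notin_setE /= => sc; rewrite /f/= (_ : xsection _ _ = set0).
  exact: lebesgue_rV_set0.
apply/seteqP; split => // y; rewrite /xsection/= inE => /BH/=.
rewrite dE v0 dotvC dotv0l addr0 => sE; apply: sc.
by rewrite -sE mulfK.
Qed.

Lemma ac_hyperplane (R : realType) (n : nat) (sigma : probability 'rV[R]_n R)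
    (t : 'rV[R]_n) (c : R) :
  sigma `<< @lebesgue_rV R n -> t != 0 ->
  sigma [set x | dotv x t = c] = 0%E.
Proof.
move=> ac t0.
have mH : measurable [set x : 'rV[R]_n | dotv x t = c].
  rewrite -[X in measurable X]setTI.
  exact: (measurable_dotv (@measurable_id _ _ setT) (measurable_cst t)
    measurableT (measurable_set1 c)).
(* Null sets for [lebesgue_rV] are those whose measurable subsets all have value zero, which is what
   [lebesgue_rV_hyperplane] provides. *)
apply: (ac [set x | dotv x t = c]) => // A mA AH.
exact: lebesgue_rV_hyperplane t0 AH.
Qed.

(** * Distribution functions *)

Section ProbabilityContinuity.
Context {R : realType} {d : measure_display} {T : measurableType d}.
Variable P : probability T R.
Implicit Types (F : (set T)^nat) (f g : T -> R).

Lemma probability_bigcup_le F (c : \bar R) : (forall k, measurable (F k)) ->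
  {homo F : n m / (n <= m)%N >-> (n <= m)%O} ->
  (forall k, P (F k) <= c)%E -> (P (\bigcup_k F k) <= c)%E.
Proof.
move=> mF ndF Fc.
have /cvg_lim <-// := nondecreasing_cvg_mu (mu := P) mF (bigcupT_measurable _ mF) ndF.
apply: lime_le; last exact: nearW.
by apply: cvgP; exact: nondecreasing_cvg_mu (bigcupT_measurable _ mF) ndF.
Qed.

Lemma probability_bigcap_ge F (c : \bar R) : (forall k, measurable (F k)) ->
  {homo F : n m / (n <= m)%N >-> (m <= n)%O} ->
  (forall k, c <= P (F k))%E -> (c <= P (\bigcap_k F k))%E.
Proof.
move=> mF niF Fc.
have F0 : (P (F 0%N) < +oo)%E.
  by rewrite ltey_eq fin_num_measure.
have /cvg_lim <-// := nonincreasing_cvg_mu (mu := P) F0 mF (bigcapT_measurable mF) niF.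
apply: lime_ge; last exact: nearW.
by apply: cvgP; exact: nonincreasing_cvg_mu F0 mF (bigcapT_measurable mF) niF.
Qed.

Lemma measurable_leset f g : measurable_fun setT f -> measurable_fun setT g ->
  measurable [set x | f x <= g x].
Proof. by move=> mf mg; rewrite -[X in measurable X]setTI; exact: measurable_fun_le. Qed.

Lemma measurable_ltset f g : measurable_fun setT f -> measurable_fun setT g ->
  measurable [set x | f x < g x].
Proof.
move=> mf mg; rewrite (_ : [set _ | _] = ~` [set x | g x <= f x]).
  by apply: measurableC; exact: measurable_leset.
by apply/seteqP; split => x /=; rewrite ltNge => /negP.
Qed.

Lemma measurable_leset_cst f (c : R) : measurable_fun setT f ->
  measurable [set x | f x <= c].
Proof. by move=> mf; exact: (measurable_leset mf (measurable_cst c)). Qed.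

Lemma measurable_ltset_cst f (c : R) : measurable_fun setT f ->
  measurable [set x | c < f x].
Proof. by move=> mf; exact: (measurable_ltset (measurable_cst c) mf). Qed.

End ProbabilityContinuity.

Section DistributionFunction.
Context {R : realType} {d : measure_display} {T : measurableType d}.
Variables (P : probability T R) (X : T -> R).
Hypothesis mX : measurable_fun setT X.

Let F := cdf_of (pushforward P X).

Lemma cdf_ofE t : (F t)%:E = P [set w | X w <= t].
Proof.
rewrite /F /cdf_of /pushforward fineK.
  by congr (P _); apply/seteqP; split => w /=; rewrite in_itv.
apply: fin_num_measure; rewrite -[X in measurable X]setTI; exact: mX.
Qed.

Lemma cdf_of_homo : {homo F : s t / s <= t}.
Proof.
move=> s t st; rewrite -lee_fin !cdf_ofE; apply: le_measure; rewrite ?inE.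
- exact: measurable_leset_cst.
- exact: measurable_leset_cst.
- by move=> w /= /le_trans; exact.
Qed.

Lemma cdf_of_ge0 t : 0 <= F t.
Proof. by rewrite -lee_fin cdf_ofE. Qed.

Lemma cdf_of_le1 t : F t <= 1.
Proof.
by rewrite -lee_fin cdf_ofE; apply: probability_le1; exact: measurable_leset_cst.
Qed.

Lemma measurable_cdf_of : measurable_fun setT F.
Proof. by apply: nondecreasing_measurable => //; exact: cdf_of_homo. Qed.

Let inv_le (k m : nat) : (k <= m)%N -> m.+1%:R^-1 <= k.+1%:R^-1 :> R.
Proof. by move=> km; rewrite lef_pV2 ?posrE// ler_nat. Qed.

Let small_inv (s t : R) : s < t -> exists k : nat, k.+1%:R^-1 < t - s.
Proof.
move=> st; exists (Num.truncn (t - s)^-1).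
by rewrite invf_plt ?posrE ?subr_gt0// truncnS_gt.
Qed.

(** The event [X <= t] is the decreasing intersection of the events [X <= t + k.+1%:R^-1]; this is
    right-continuity of [F] in the form used below. *)
Lemma cdf_of_right c t : (forall s, t < s -> c <= F s) -> c <= F t.
Proof.
move=> h; rewrite -lee_fin cdf_ofE.
rewrite (_ : [set _ | _] = \bigcap_k [set w | X w <= t + k.+1%:R^-1]).
  apply: probability_bigcap_ge => [k|k m km|k]; first exact: measurable_leset_cst.
    by apply/subsetPset => w /= /le_trans; apply; rewrite lerD2l inv_le.
  by rewrite -cdf_ofE lee_fin h// ltrDl.
apply/seteqP; split => w /= => [Xt k _|Xt] /=.
  by rewrite (le_trans Xt)// lerDl.
rewrite leNgt; apply/negP => tX.
have [k] := small_inv tX.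
by have /= := Xt k I; rewrite leNgt ltrBrDl => /negP.
Qed.

(** The event [X < t] is the increasing union of the events [X <= t - k.+1%:R^-1], and without an
    atom at [t] it has the probability of [X <= t]. This is left-continuity of [F] at [t]. *)
Lemma cdf_of_left c t : P [set w | X w = t] = 0%E ->
  (forall s, s < t -> F s <= c) -> F t <= c.
Proof.
move=> Pt h; rewrite -lee_fin cdf_ofE.
have mt : measurable [set w | X w = t].
  by rewrite -[X in measurable X]setTI; exact: (mX measurableT (measurable_set1 t)).
have mltt : measurable [set w | X w < t].
  exact: (measurable_ltset mX (measurable_cst t)).
rewrite (_ : [set _ | _] = [set w | X w < t] `|` [set w | X w = t]); last first.
  apply/seteqP; split => w /=; last by move=> [/ltW|->].
  by rewrite le_eqVlt => /predU1P[->|]; [right|left].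
rewrite measureU//; last first.
  by apply/seteqP; split => // w /= [+ Xt]; rewrite Xt ltxx.
rewrite /= Pt adde0.
rewrite (_ : [set _ | _] = \bigcup_k [set w | X w <= t - k.+1%:R^-1]).
  apply: probability_bigcup_le => [k|k m km|k]; first exact: measurable_leset_cst.
    by apply/subsetPset => w /= /le_trans; apply; rewrite lerD2l lerN2 inv_le.
  by rewrite -cdf_ofE lee_fin h// ltrBlDr ltrDl.
apply/seteqP; split => w /= => [Xt|[k _] /=].
  have [k kX] := small_inv Xt.
  by exists k => //=; rewrite lerBrDr addrC -lerBrDr ltW.
by move=> /le_lt_trans; apply; rewrite ltrBlDr ltrDl.
Qed.

Lemma cdf_of_gt c : c < 1 -> exists t, c < F t.
Proof.
move=> c1; apply/not_existsP => h.
have : (P setT <= c%:E)%E.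
  rewrite (_ : setT = \bigcup_k [set w | X w <= k%:R]).
    apply: probability_bigcup_le => [k|k m km|k]; first exact: measurable_leset_cst.
      by apply/subsetPset => w /= /le_trans; apply; rewrite ler_nat.
    by rewrite -cdf_ofE lee_fin leNgt; apply/negP.
  apply/seteqP; split => // w _; exists (Num.truncn (X w)).+1 => //=.
  by rewrite ltW// truncnS_gt.
by rewrite probability_setT lee_fin leNgt c1.
Qed.

Lemma cdf_of_lt c : 0 < c -> exists t, F t < c.
Proof.
move=> c1; apply/not_existsP => h.
have : (c%:E <= P set0)%E.
  rewrite (_ : set0 = \bigcap_k [set w | X w <= - k%:R]).
    apply: probability_bigcap_ge => [k|k m km|k]; first exact: measurable_leset_cst.
      by apply/subsetPset => w /= /le_trans; apply; rewrite lerN2 ler_nat.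
    by rewrite -cdf_ofE lee_fin leNgt; apply/negP.
  apply/seteqP; split => // w Xw; have := Xw (Num.truncn (- X w)).+1 I.
  by rewrite /= lerNr leNgt truncnS_gt.
by rewrite measure0 lee_fin leNgt c1.
Qed.

Hypothesis atomless : forall t, P [set w | X w = t] = 0%E.

(** Probability integral transform: with [s] the supremum of the [t] such that [F t <= c],
    continuity gives [F s = c], and the event becomes [X <= s]. *)
Lemma probability_cdf_of_le c : 0 <= c <= 1 -> P [set w | F (X w) <= c] = c%:E.
Proof.
move=> /andP[c0]; rewrite le_eqVlt => /predU1P[->|c1].
  (* For [c = 1] the set whose supremum is taken would be the whole line. *)
  rewrite -(@probability_setT _ _ _ P); congr (P _).
  by apply/seteqP; split => // w _; exact: cdf_of_le1.
have [t0 t0c] := cdf_of_gt c1.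
have ubt0 : ubound [set t | F t <= c] t0.
  move=> t /= tc; rewrite leNgt; apply/negP => /ltW/cdf_of_homo.
  by rewrite leNgt (le_lt_trans tc).
(* If [F] never falls to [c], then [c = 0], because [F] takes values below any positive number. *)
have [[t1 t1c]|ne] := pselect ([set t | F t <= c] !=set0); last first.
  have -> : [set w | F (X w) <= c] = set0.
    by apply/seteqP; split => // w Fc; case: ne; exists (X w).
  rewrite measure0; congr (_%:E); apply/le_anti; rewrite c0/= leNgt.
  by apply/negP => /cdf_of_lt[t /ltW tc]; apply: ne; exists t.
pose s := sup [set t | F t <= c].
have hs : has_sup [set t | F t <= c] by split; [exists t1|exists t0].
have sc : F s = c.
  apply/le_anti/andP; split.
    apply: cdf_of_left => // t ts.
    have st : 0 < s - t by rewrite subr_gt0.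
    have [t' /= t'c tt'] := sup_adherent st hs.
    by apply: le_trans t'c; apply: cdf_of_homo; move: tt'; rewrite subKr => /ltW.
  apply: cdf_of_right => t st; rewrite leNgt; apply/negP => /ltW tc.
  by have := ub_le_sup hs.2 tc; rewrite leNgt st.
rewrite -sc cdf_ofE; congr (P _); apply/seteqP; split => w /=.
  by rewrite sc => Xc; apply: ub_le_sup => //; exact: hs.2.
exact: cdf_of_homo.
Qed.

(** Both conditions are downward closed in [X], so one event contains the other. *)
Lemma probability_cdf_of_le_le c t : 0 <= c <= 1 ->
  P [set w | X w <= t /\ F (X w) <= c] = (Num.min (F t) c)%:E.
Proof.
move=> c01; have [Ftc|cFt] := leP (F t) c.
  rewrite cdf_ofE; congr (P _); apply/seteqP; split => w /=; first by case.
  by move=> Xt; split => //; rewrite (le_trans _ Ftc)// cdf_of_homo.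
rewrite -(probability_cdf_of_le c01); congr (P _).
apply/seteqP; split => w /=; first by case.
move=> Xc; split => //; rewrite leNgt; apply/negP => /ltW/cdf_of_homo.
by rewrite leNgt (le_lt_trans Xc).
Qed.

(** Discards the levels 0 and 1, at which [quantile] may take default values. If [1 <= F (X w)] had
    probability [p > 0], it would lie in the event [1 - p / 2 < F (X w)], of probability [p / 2]. *)
Lemma probability_cdf_of_ext : P [set w | ~ (0 < F (X w) < 1)] = 0%E.
Proof.
have m0 : measurable [set w | F (X w) <= 0].
  apply: measurable_leset_cst; exact: (measurableT_comp measurable_cdf_of mX).
have m1 : measurable [set w | 1 <= F (X w)].
  apply: measurable_leset => //; exact: (measurableT_comp measurable_cdf_of mX).
rewrite (_ : [set _ | _] = [set w | F (X w) <= 0] `|` [set w | 1 <= F (X w)]); last first.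
  apply/seteqP; split => w /=.
    by move/negP; rewrite negb_and -!leNgt => /orP.
  by move=> h /andP[]; rewrite !ltNge; case: h => ->.
have P0 : P [set w | F (X w) <= 0] = 0%E.
  by rewrite probability_cdf_of_le ?lexx ?ler01.
set A := [set w | 1 <= F (X w)].
suff PA : P A = 0%E by exact: (null_set_setU m0 m1 P0 PA).
apply/eqP; rewrite eq_le measure_ge0 andbT leNgt; apply/negP => A0.
have Afin : P A \is a fin_num by exact: fin_num_measure.
move: A0; rewrite -(fineK Afin) lte_fin; set p := fine _ => p0.
have p1 : p <= 1 by rewrite -lee_fin fineK//; exact: probability_le1.
have c01 : 0 <= 1 - p / 2 <= 1 by apply/andP; split; lra.
have mc : measurable [set w | F (X w) <= 1 - p / 2].
  apply: measurable_leset_cst; exact: (measurableT_comp measurable_cdf_of mX).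
have : (P A <= P (~` [set w | F (X w) <= 1 - p / 2]%R))%E.
  apply: le_measure; rewrite ?inE//; first exact: measurableC.
  by move=> w; rewrite /A /= => h; apply/negP; rewrite -ltNge; lra.
rewrite probability_setC// probability_cdf_of_le// -(fineK Afin) -/p.
by rewrite -EFinB lee_fin; lra.
Qed.

End DistributionFunction.

(** * Optimality of the quantile map on the line *)

Section Quantile.
Context {R : realType} {d : measure_display} {T : measurableType d}.
Variables (P : probability T R) (X : T -> R).
Hypothesis mX : measurable_fun setT X.

Let F := cdf_of (pushforward P X).
Let q := quantile (pushforward P X).

(** Right-continuity of [F] makes the infimum defining [q u] attained, so [q] and [F] form a Galois
    connection. For [0 < u < 1] that infimum is over a non-empty set bounded below. *)
Lemma quantile_le (u v : R) : 0 < u < 1 -> (q u <= v) = (u <= F v).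
Proof.
move=> /andP[u0 u1].
have lb : has_lbound [set t | u <= F t].
  have [t tu] := cdf_of_lt P mX u0; exists t => s /= us.
  rewrite leNgt; apply/negP => /ltW/(cdf_of_homo P mX) st.
  by have := le_lt_trans (le_trans us st) tu; rewrite ltxx.
have ne : [set t | u <= F t] !=set0.
  by have [t /ltW tu] := cdf_of_gt P mX u1; exists t.
apply/idP/idP => [quv|]; last exact: ge_inf.
apply: (@cdf_of_right _ _ _ P X mX) => s vs.
have sq : 0 < s - q u by rewrite subr_gt0 (le_lt_trans quv).
have [t /= ut] := inf_adherent sq (conj ne lb).
rewrite subrKC => /ltW/(cdf_of_homo P mX); exact: le_trans.
Qed.

End Quantile.

Lemma same_law_le (R : realType) d1 d2 (T1 : measurableType d1)
    (T2 : measurableType d2) (P : probability T1 R) (Q : probability T2 R)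
    (X : T1 -> R) (Y : T2 -> R) (t : R) :
  same_law P Q X Y -> P [set w | X w <= t] = Q [set w | Y w <= t].
Proof.
move=> XY.
have E (U : Type) (Z : U -> R) : [set w | Z w <= t] = Z @^-1` `]-oo, t].
  by apply/seteqP; split => w /=; rewrite in_itv.
by rewrite (E _ X) (E _ Y); exact: (XY _ (measurable_itv _)).
Qed.

(** Open right half-lines are stable under intersection and generate the Borel sets; their preimages
    are the complements of the events compared here. *)
Lemma same_law_cdf (R : realType) d1 d2 (T1 : measurableType d1)
    (T2 : measurableType d2) (P : probability T1 R) (Q : probability T2 R)
    (X : T1 -> R) (Y : T2 -> R) :
  measurable_fun setT X -> measurable_fun setT Y ->
  (forall t, P [set w | X w <= t] = Q [set w | Y w <= t]) ->
  same_law P Q X Y.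
Proof.
move=> mX mY XY.
pose mXm := isMeasurableFun.Build _ _ _ _ X mX.
pose mYm := isMeasurableFun.Build _ _ _ _ Y mY.
pose X' : {mfun T1 >-> R} := HB.pack X mXm.
pose Y' : {mfun T2 >-> R} := HB.pack Y mYm.
suff : forall A, measurable A -> distribution P X' A = distribution Q Y' A by [].
apply: (@measure_unique _ R R (@RGenOInfty.G R) (fun n : nat => `]- n%:R, +oo[%classic)
  (RGenOInfty.measurableE R)).
- move=> _ _ [a ->] [b ->]; exists (Num.max a b).
  by apply/seteqP; split => t /=; rewrite !in_itv/= !andbT gt_max => /andP.
- by move=> n; exists (- n%:R).
- apply/seteqP; split => // t _; exists (Num.truncn (- t)).+1 => //=.
  by rewrite in_itv/= andbT ltrNl truncnS_gt.
- move=> _ [a ->].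
  have E (U : Type) (Z : U -> R) :
      Z @^-1` `]a, +oo[ = ~` [set w | Z w <= a].
    by apply/seteqP; split => w /=; rewrite in_itv/= andbT ltNge => /negP.
  transitivity (P (~` [set w | X w <= a])); first by congr (P _); exact: E.
  transitivity (Q (~` [set w | Y w <= a])); last by congr (Q _); rewrite E.
  by rewrite !probability_setC ?XY//; exact: measurable_leset_cst.
- by move=> k; rewrite ltey_eq fin_num_measure.
Qed.

(* Layer-cake representation: [max (y - x) 0 ^+ 2] is the area of the square
   of side [`[x, y[]. Existential over the plane [S] because [lebesgue_measure]
   lives on [measurableTypeR R], whose structure does not unify with that of [R]. *)
Lemma square_area (R : realType) : exists (d : measure_display)
    (S : measurableType d) (m : {sigma_finite_measure set S -> \bar R})
    (u v : S -> R), [/\ measurable_fun setT u, measurable_fun setT v &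
  forall x y, m [set z | x <= Num.min (u z) (v z) /\ Num.max (u z) (v z) < y] =
    (Num.max (y - x) 0 ^+ 2)%:E].
Proof.
have L (x y : R) : lebesgue_measure (`[x, y[%classic : set R) =
    (Num.max (y - x) 0)%:E.
  rewrite lebesgue_measure_itv/= lte_fin; case: ltP => xy.
    by rewrite -EFinB max_l// subr_ge0 ltW.
  by rewrite max_r// subr_le0.
pose m : {measure set (measurableTypeR R * measurableTypeR R)%type -> \bar R} :=
  (@lebesgue_measure R \x @lebesgue_measure R)%E.
have mE (x y : R) : m (`[x, y[%classic `*` `[x, y[%classic) =
    (Num.max (y - x) 0 ^+ 2)%:E.
  rewrite EFinM -L; apply: product_measure1E; exact: measurable_itv.
have sm : sigma_finite setT m.
  exists (fun n : nat => `[- n%:R, n%:R[%classic `*` `[- n%:R, n%:R[%classic).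
    apply/seteqP; split => // -[x y] _.
    exists (Num.truncn (Num.max `|x| `|y|)).+1 => //=.
    have := truncnS_gt (Num.max `|x| `|y|); rewrite gt_max.
    rewrite !ltr_norml !in_itv/= => /andP[/andP[? ?] /andP[? ?]].
    by split; apply/andP; split => //; exact/ltW.
  move=> n; split; first by apply: measurableX; exact: measurable_itv.
  by rewrite mE ltry.
pose m' : {sigma_finite_measure set _ -> \bar R} :=
  HB.pack (Measure.sort m) (Measure.class m) (Measure_isSigmaFinite.Build _ _ _ m sm).
exists _, _, m', fst, snd; split; [exact: measurable_fst|exact: measurable_snd|].
move=> x y; rewrite -mE; congr (m _).
apply/seteqP; split => -[u v] /=; rewrite le_min gt_max !in_itv/=.
  by move=> [/andP[-> ->] /andP[-> ->]].
by move=> [/andP[-> ->] /andP[-> ->]].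
Qed.

(** Tonelli: for each [w] the area of the square is the measure of a section of [D], and exchanging
    the integrals replaces it by the probability of the section in the other variable. *)
Lemma integral_sqr_pos_part (R : realType) d (T : measurableType d)
    (P : probability T R) d' (S : measurableType d')
    (m : {sigma_finite_measure set S -> \bar R}) (u v : S -> R)
    (X Y : T -> R) :
  measurable_fun setT u -> measurable_fun setT v ->
  (forall x y, m [set z | x <= Num.min (u z) (v z) /\ Num.max (u z) (v z) < y] =
    (Num.max (y - x) 0 ^+ 2)%:E) ->
  measurable_fun setT X -> measurable_fun setT Y ->
  let g z := P [set w | X w <= Num.min (u z) (v z) /\ Num.max (u z) (v z) < Y w] in
  measurable_fun setT g /\
  (\int[P]_w (Num.max (Y w - X w) 0 ^+ 2)%:E = \int[m]_z g z)%E.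
Proof.
move=> mu mv mE mX mY g.
pose D : set (T * S) := [set z | X z.1 <= Num.min (u z.2) (v z.2)] `&`
  [set z | Num.max (u z.2) (v z.2) < Y z.1].
have mu2 : measurable_fun setT (fun z : T * S => u z.2).
  exact: (measurableT_comp mu measurable_snd).
have mv2 : measurable_fun setT (fun z : T * S => v z.2).
  exact: (measurableT_comp mv measurable_snd).
have mD : measurable D.
  apply: measurableI.
    apply: measurable_leset; first exact: (measurableT_comp mX measurable_fst).
    exact: measurable_minr.
  apply: measurable_ltset; last exact: (measurableT_comp mY measurable_fst).
  exact: measurable_maxr.
have gE z : g z = P (ysection D z).
  congr (P _); apply/seteqP.
  by split => w; [move=> h; exact/ysectionP|move/ysectionP].
split; first by rewrite (funext gE); exact: measurable_fun_ysection.
have indicE' d'' (T' : measurableType d'') (n : {measure set T' -> \bar R}) A :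
    measurable A -> (n A = \int[n]_z (\1_A z)%:E)%E.
  by move=> mA; rewrite integral_indic// setIT.
transitivity (\int[P]_w \int[m]_z (\1_D (w, z))%:E)%E.
  apply: eq_integral => w _; rewrite -mE.
  rewrite (_ : [set z | _] = xsection D w); last first.
    by apply/seteqP; split => z; [move=> h; exact/xsectionP|move/xsectionP].
  rewrite (indicE' _ _ m _ (measurable_xsection w mD)).
  apply: eq_integral => z _; rewrite !indicE; congr (_%:R%:E).
  by rewrite mem_xsection.
rewrite (@fubini_tonelli _ _ _ _ _ P m (fun z => (\1_D z)%:E)); last 2 first.
- exact/measurable_EFinP.
- by move=> z; rewrite lee_fin.
apply: eq_integral => z _.
rewrite gE (indicE' _ _ P _ (measurable_ysection z mD)).
apply: eq_integral => w _; rewrite !indicE; congr (_%:R%:E).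
by rewrite mem_ysection.
Qed.

(** The layer-cake formula is increasing in these joint probabilities, the only feature of the two
    pairs that it sees. *)
Lemma le_integral_sqr_pos_part (R : realType) d1 d2 (T1 : measurableType d1)
    (T2 : measurableType d2) (P : probability T1 R) (Q : probability T2 R)
    (X Y : T1 -> R) (X' Y' : T2 -> R) :
  measurable_fun setT X -> measurable_fun setT Y ->
  measurable_fun setT X' -> measurable_fun setT Y' ->
  (forall s t, P [set w | X w <= s /\ t < Y w]%R <=
     Q [set w | X' w <= s /\ t < Y' w]%R)%E ->
  (\int[P]_w (Num.max (Y w - X w) 0 ^+ 2)%:E <=
   \int[Q]_w (Num.max (Y' w - X' w) 0 ^+ 2)%:E)%E.
Proof.
move=> mX mY mX' mY' PQ.
have [d [S [m [u [v [mu mv mE]]]]]] := square_area R.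
have [m1 ->] := integral_sqr_pos_part P mu mv mE mX mY.
have [m2 ->] := integral_sqr_pos_part Q mu mv mE mX' mY'.
by apply: ge0_le_integral => // z _; exact: PQ.
Qed.

Lemma integral_sqr_diff (R : realType) d (T : measurableType d)
    (P : probability T R) (X Y : T -> R) :
  measurable_fun setT X -> measurable_fun setT Y ->
  (\int[P]_w ((X w - Y w) ^+ 2)%:E =
   \int[P]_w (Num.max (Y w - X w) 0 ^+ 2)%:E +
   \int[P]_w (Num.max (X w - Y w) 0 ^+ 2)%:E)%E.
Proof.
move=> mX mY.
have m (f g : T -> R) : measurable_fun setT f -> measurable_fun setT g ->
    measurable_fun setT (fun w => (Num.max (f w - g w) 0 ^+ 2)%:E).
  move=> mf mg; apply: measurable_sqr_EFin; apply: measurable_maxr => //.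
  exact: measurable_funB.
rewrite -ge0_integralD//; last 4 first.
- by move=> w _; rewrite lee_fin sqr_ge0.
- exact: m.
- by move=> w _; rewrite lee_fin sqr_ge0.
- exact: m.
apply: eq_integral => w _; rewrite -EFinD; congr (_%:E).
rewrite -(opprB (X w)); case: (leP 0 (X w - Y w)) => h.
  by rewrite (max_r (_ : - _ <= 0)) ?oppr_le0// expr0n add0r.
by rewrite max_l ?oppr_ge0 1?ltW// sqrrN expr0n addr0.
Qed.

Section MonotoneTransport.
Context {R : realType} {d1 d2 : measure_display}.
Context {T1 : measurableType d1} {T2 : measurableType d2}.
Variables (P : probability T1 R) (Q : probability T2 R).
Variables (X : T1 -> R) (Y : T2 -> R).
Hypotheses (mX : measurable_fun setT X) (mY : measurable_fun setT Y).
Hypothesis atomless : forall t, P [set w | X w = t] = 0%E.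

Let F := cdf_of (pushforward P X).
Let G := cdf_of (pushforward Q Y).
Let tau := transport_map_1d (pushforward P X) (pushforward Q Y).

(** On [F t = 0] and on [F t = 1] the map is constant; elsewhere [quantile_le] turns [a < tau t]
    into [G a < F t]. *)
Lemma measurable_transport_map_1d : measurable_fun setT tau.
Proof.
apply: (measurability _ (RGenOInfty.measurableE R)) => _ [_ [a ->] <-].
rewrite setTI.
have mF := measurable_cdf_of P mX.
have -> : tau @^-1` `]a, +oo[ =
    [set t | F t = 0 /\ a < quantile (pushforward Q Y) 0] `|`
    [set t | F t = 1 /\ a < quantile (pushforward Q Y) 1] `|`
    [set t | G a < F t /\ 0 < F t < 1].
  apply/seteqP; split => t /=; rewrite in_itv/= andbT /tau /transport_map_1d -/F.
    have := cdf_of_ge0 P mX t; have := cdf_of_le1 P mX t; rewrite -/F.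
    rewrite !le_eqVlt => /predU1P[-> _|F1 /predU1P[<-|F0]].
    - by left; right.
    - by left; left.
    - have F01 : 0 < F t < 1 by rewrite F0 F1.
      by rewrite ltNge (quantile_le Q mY)// -ltNge => ?; right.
  move=> [[[-> //]|[-> //]]|[GF F01]].
  by rewrite ltNge (quantile_le Q mY)// -ltNge.
have mS (b : bool) : measurable [set _ : R | b].
  case: b; first by rewrite (_ : [set _ | _] = setT)//; apply/seteqP; split.
  by rewrite (_ : [set _ | _] = set0)//; apply/seteqP; split.
have m1 (c : R) : measurable [set t | F t = c].
  by have := mF measurableT [set c] (measurable_set1 c); rewrite setTI.
apply: measurableU; first apply: measurableU.
- by apply: measurableI; [exact: m1|exact: mS].
- by apply: measurableI; [exact: m1|exact: mS].
- apply: measurableI; first exact: measurable_ltset_cst.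
  rewrite (_ : (fun _ => _) = [set t | 0 < F t] `&` [set t | F t < 1]).
    apply: measurableI; first exact: measurable_ltset_cst.
    by apply: measurable_ltset; first exact: mF.
  by apply/seteqP; split => t /=; [move=> /andP[]|move=> [-> ->]].
Qed.

Let mtau : measurable_fun setT (tau \o X).
Proof. exact: measurableT_comp measurable_transport_map_1d mX. Qed.

Let mFX : measurable_fun setT (F \o X).
Proof. exact: measurableT_comp (measurable_cdf_of P mX) mX. Qed.

(* [tau (X w) <= v] iff [F (X w) <= G v] outside the null event [F \o X \in {0, 1}]. *)
Let eq_transport (A : set T1) (v : R) : measurable A ->
  P (A `&` [set w | tau (X w) <= v]) = P (A `&` [set w | F (X w) <= G v]).
Proof.
move=> mA.
have mN : measurable [set w | ~ (0 < F (X w) < 1)].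
  rewrite (_ : [set _ | _] = [set w | F (X w) <= 0] `|` [set w | 1 <= F (X w)]).
    apply: measurableU; first exact: measurable_leset_cst.
    exact: measurable_leset.
  apply/seteqP; split => w /=.
    by move/negP; rewrite negb_and -!leNgt => /orP.
  by move=> h /andP[]; rewrite !ltNge; case: h => ->.
have N0 := probability_cdf_of_ext mX atomless.
have mB : measurable (A `&` [set w | tau (X w) <= v]).
  by apply: measurableI => //; exact: measurable_leset_cst.
have mC : measurable (A `&` [set w | F (X w) <= G v]).
  by apply: measurableI => //; exact: measurable_leset_cst.
(* Adjoining the null event to both sides makes the two events equal. *)
rewrite -(measureU0 mB mN N0) -(measureU0 mC mN N0); congr (P _).
have E w : 0 < F (X w) < 1 -> (tau (X w) <= v) = (F (X w) <= G v).
  by move=> h; rewrite /tau /transport_map_1d (quantile_le Q mY).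
apply/seteqP; split => w /=; (case=> [[Aw h]|]; last by right);
  have [n|n] := pselect (0 < F (X w) < 1); try by right.
  by left; split => //; rewrite -E.
by left; split => //; rewrite E.
Qed.

Let G01 v : 0 <= G v <= 1.
Proof. by rewrite (cdf_of_ge0 Q mY) (cdf_of_le1 Q mY). Qed.

(** [F \o X] is uniform, so the event [F (X w) <= G v] has probability [G v]. *)
Lemma same_law_transport_map_1d : same_law P Q (tau \o X) Y.
Proof.
apply: same_law_cdf => // v.
have := eq_transport v measurableT; rewrite !setTI => ->.
by rewrite probability_cdf_of_le// -cdf_ofE.
Qed.

(** Every coupling gives [X' <= s] and [t < Y'] a joint probability of at least [F s - G t]. For the
    monotone map it is exactly the positive part of this number, and likewise with the roles
    exchanged, so both layer-cake terms are minimal. *)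
Lemma transport_map_1d_optimal d (T : measurableType d)
    (M : probability T R) (X' Y' : T -> R) :
  measurable_fun setT X' -> measurable_fun setT Y' ->
  same_law M P X' X -> same_law M Q Y' Y ->
  (\int[P]_w ((X w - tau (X w)) ^+ 2)%:E <=
   \int[M]_w ((X' w - Y' w) ^+ 2)%:E)%E.
Proof.
move=> mX' mY' XX' YY'.
have FE s : M [set w | X' w <= s] = (F s)%:E.
  by rewrite cdf_ofE// (same_law_le s XX').
have GE s : M [set w | Y' w <= s] = (G s)%:E.
  by rewrite cdf_ofE// (same_law_le s YY').
(* Frechet lower bound: the event [f <= s] is covered by the joint event and by [g <= t]. *)
have lower (f g : T -> R) (a b s t : R) : measurable_fun setT f ->
    measurable_fun setT g -> M [set w | f w <= s] = a%:E ->
    M [set w | g w <= t] = b%:E ->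
    ((a - b)%:E <= M [set w | (f w <= s)%R /\ (t < g w)%R])%E.
  move=> mf mg fa gb.
  have mfs := measurable_leset_cst s mf.
  have mgt := measurable_leset_cst t mg.
  have mgt' := measurable_ltset_cst t mg.
  rewrite EFinB leeBlDr// -fa -gb.
  apply: le_trans (measureU2 _ _ _) => //; last exact: measurableI.
  apply: le_measure; rewrite ?inE//.
    by apply: measurableU => //; exact: measurableI.
  by move=> w /= fs; have [gt|gt] := leP (g w) t; [right|left].
rewrite !integral_sqr_diff//; apply: leeD; apply: le_integral_sqr_pos_part => //.
- move=> s t.
  have -> : P [set w | X w <= s /\ t < tau (X w)] =
      (F s - Num.min (F s) (G t))%:E.
    rewrite (_ : [set _ | _] = [set w | X w <= s] `\` [set w | tau (X w) <= t]).
      rewrite measureD//; last 3 first.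
      + exact: measurable_leset_cst.
      + exact: measurable_leset_cst.
      + by rewrite ltey_eq fin_num_measure//; exact: measurable_leset_cst.
      rewrite /= eq_transport; last exact: measurable_leset_cst.
      have := probability_cdf_of_le_le mX atomless s (G01 t).
      by rewrite /setI/= -/F => ->; rewrite -cdf_ofE.
    apply/seteqP; split => w /= [h1 h2]; split => //.
      by rewrite leNgt h2.
    by rewrite ltNge; apply/negP.
  have [h|h] := leP (F s) (G t); first by rewrite subrr measure_ge0.
  exact: lower.
- move=> s t.
  have -> : P [set w | tau (X w) <= s /\ t < X w] =
      (G s - Num.min (F t) (G s))%:E.
    rewrite (_ : [set _ | _] = [set w | tau (X w) <= s] `\` [set w | X w <= t]).
      rewrite measureD//; last 3 first.
      + exact: measurable_leset_cst.
      + exact: measurable_leset_cst.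
      + by rewrite ltey_eq fin_num_measure//; exact: measurable_leset_cst.
      rewrite /= [X in (_ - P X)%E]setIC eq_transport; last exact: measurable_leset_cst.
      have := eq_transport s measurableT; rewrite !setTI => ->.
      rewrite probability_cdf_of_le//.
      have := probability_cdf_of_le_le mX atomless t (G01 s).
      by rewrite /setI/= -/F => ->.
    apply/seteqP; split => w /= [h1 h2]; split => //.
      by rewrite leNgt h2.
    by rewrite ltNge; apply/negP.
  have [h|h] := leP (F t) (G s); last by rewrite subrr measure_ge0.
  exact: lower.
Qed.

End MonotoneTransport.

(** * Best scaling-translation *)

Section AffineCost.
Context {R : realType} {d : measure_display} {T : measurableType d} {n : nat}.
Variables (P : probability T R) (X Y : T -> 'rV[R]_n).
Hypotheses (sX : sq_integrable_rV P X) (sY : sq_integrable_rV P Y).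

(** Bilinearity. Once the laws of [X] and [Y] are fixed, their pairing enters only through
    [corr P X Y]. *)
Lemma corr_affine (a : R) (b : 'rV[R]_n) :
  corr P (fun w => a *: X w + b - Y w) (fun w => a *: X w + b - Y w) =
  a ^+ 2 * corr P X X + 2 * a * dotv b (expect P X) + dotv b b
  - 2 * a * corr P X Y - 2 * dotv b (expect P Y) + corr P Y Y.
Proof.
have sb := sq_integrable_rV_cst P b.
have saX := sq_integrable_rVZ a sX.
have sS := sq_integrable_rVD saX sb.
have sZ := sq_integrable_rVB sS sY.
have bb : corr P (fun=> b) (fun=> b) = dotv b b.
  by rewrite /corr Rintegral_cst//= probability_setT mulr1.
(* Expansion of the left argument against an arbitrary [Z]; by symmetry it then serves for [X], [Y],
   the constant [b] and the difference itself. *)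
have expand Z : sq_integrable_rV P Z ->
    corr P (fun w => a *: X w + b - Y w) Z =
    a * corr P X Z + dotv b (expect P Z) - corr P Y Z.
  by move=> sZ'; rewrite corrBl// corrDl// corrZl// corr_cst.
set Z := fun w => a *: X w + b - Y w in sZ *.
have bZ : dotv b (expect P Z) =
    a * dotv b (expect P X) + dotv b b - dotv b (expect P Y).
  rewrite -(corr_cst b sZ) (corrC P _ Z) (expand _ sb) -(corr_cst b sb) bb.
  by rewrite (corrC P X) (corrC P Y) !corr_cst.
rewrite (expand _ sZ) bZ (corrC P X Z) (corrC P Y Z) !expand//.
by rewrite (corrC P Y X); ring.
Qed.

End AffineCost.

Lemma corr_diff {R : realType} {d : measure_display} {T : measurableType d}
    {n : nat} (P : probability T R) (X Y : T -> 'rV[R]_n) :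
  sq_integrable_rV P X -> sq_integrable_rV P Y ->
  corr P (fun w => X w - Y w) (fun w => X w - Y w) =
  corr P X X - 2 * corr P X Y + corr P Y Y.
Proof.
move=> sX sY; have := corr_affine sX sY 1 0.
rewrite !dotv0l !mulr0 subr0 !addr0 expr1n mul1r mulr1 => <-.
by apply: eq_Rintegral => w _; rewrite scale1r addr0.
Qed.

Lemma L2norm_corr (R : realType) (n : nat) (sigma : probability 'rV[R]_n R)
    (F : 'rV[R]_n -> 'rV[R]_n) : sq_integrable_rV sigma F ->
  L2norm sigma F = sqrte (corr sigma F F)%:E.
Proof. by move=> sF; rewrite /L2norm integral_enorm_sqr. Qed.

(** Optimality of [T] between [sigma] and its image, stated as maximal correlation: with both laws
    fixed, the quadratic cost varies only through [corr]. Arbitrary pairs of random vectors stand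
    for couplings. *)
Definition max_corr {R : realType} {n : nat} (sigma : probability 'rV[R]_n R)
    (T : 'rV[R]_n -> 'rV[R]_n) : Prop :=
  forall (d : measure_display) (W : measurableType d) (P : probability W R)
    (X Y : W -> 'rV[R]_n), measurable_fun setT X -> measurable_fun setT Y ->
    same_law P sigma X id -> same_law P sigma Y T ->
    corr P X Y <= corr sigma id T.

Lemma measurable_enormB (R : realType) (n : nat) :
  measurable_fun setT (fun z : 'rV[R]_n * 'rV[R]_n => enorm (z.1 - z.2)).
Proof.
have m : measurable_fun setT (fun z : 'rV[R]_n * 'rV[R]_n => z.1 - z.2).
  apply: measurable_rV => i; under eq_fun do rewrite !mxE.
  apply: measurable_funB.
    exact: (measurableT_comp (measurable_coord i) measurable_fst).
  exact: (measurableT_comp (measurable_coord i) measurable_snd).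
have msqrt : measurable_fun setT (@Num.sqrt R).
  exact: (nondecreasing_measurable measurableT (@ler_wsqrtr R)).
exact: (measurableT_comp msqrt (measurable_dotv m m)).
Qed.

Lemma measurable_scal_trans (R : realType) (n : nat) (a : R) (b : 'rV[R]_n) :
  measurable_fun setT (fun x : 'rV[R]_n => a *: x + b).
Proof.
apply: measurable_rV => i; under eq_fun do rewrite !mxE.
by apply: measurable_funD => //; apply: measurable_funM => //; exact: measurable_coord.
Qed.

Section ScalTransCost.
Context {R : realType} {n : nat}.
Variables (sigma : probability 'rV[R]_n R) (T : 'rV[R]_n -> 'rV[R]_n).
Hypothesis mT : measurable_fun setT T.
Hypotheses (sid : sq_integrable_rV sigma id) (sT : sq_integrable_rV sigma T).

(* The cross term of the quadratic cost of any coupling is linear in [a > 0],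
   so one optimal map [T] serves all the targets [a *: x + b] at once. *)
Lemma W2_scal_trans (eta : set 'rV[R]_n -> \bar R) (a : R) (b : 'rV[R]_n) :
  max_corr sigma T ->
  (forall A, measurable A -> pushforward sigma T A = eta A) -> 0 < a ->
  W2 (pushforward sigma (fun x => a *: x + b)) eta =
  L2norm sigma (fun x => a *: x + b - T x).
Proof.
move=> cT etaE a0.
have sF : sq_integrable_rV sigma (fun x => a *: x + b - T x).
  apply: sq_integrable_rVB => //; apply: sq_integrable_rVD.
    exact: sq_integrable_rVZ.
  exact: sq_integrable_rV_cst.
apply/le_anti/andP; split.
  apply: wasserstein2_le => //; [exact: measurable_scal_trans|].
  exact: measurable_enormB.
rewrite L2norm_corr//; apply: le_wasserstein2; first by rewrite lee_fin corr_ge0.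
move=> p pS.
(* Undoing the affine map on the first coordinate turns a coupling of the image of [sigma] with
   [eta] into one of [sigma] with [eta]. *)
pose X (z : 'rV[R]_n * 'rV[R]_n) := a^-1 *: z.1 + - (a^-1 *: b).
have mX : measurable_fun setT X.
  exact: (measurableT_comp (measurable_scal_trans a^-1 (- (a^-1 *: b))) measurable_fst).
have m2 : measurable_fun setT (fun z : 'rV[R]_n * 'rV[R]_n => z.2).
  exact: measurable_snd.
have XK z : a *: X z + b = z.1.
  by rewrite scalerDr scalerN !scalerA mulfV ?gt_eqF// !scale1r subrK.
have lX : same_law p sigma X id.
  move=> A mA.
  have mA' : measurable ((fun x : 'rV[R]_n => a^-1 *: x + - (a^-1 *: b)) @^-1` A).
    by rewrite -[X in measurable X]setTI; exact: measurable_scal_trans.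
  have [+ _] := pS _ mA'; rewrite /pushforward => ->.
  congr (sigma _); apply/seteqP; split => x /=;
    by rewrite scalerDr scalerA mulVf ?gt_eqF// scale1r addrK.
have l2 : same_law p sigma snd T.
  by move=> A mA; have [_ +] := pS A mA; rewrite -etaE.
have sX : sq_integrable_rV p X.
  exact: (sq_integrable_rV_same_law (@measurable_id _ _ setT) mX (same_law_sym lX) sid).
have s2 : sq_integrable_rV p snd.
  exact: (sq_integrable_rV_same_law mT m2 (same_law_sym l2) sT).
have sZ : sq_integrable_rV p (fun z => a *: X z + b - z.2).
  apply: sq_integrable_rVB => //; apply: sq_integrable_rVD.
    exact: sq_integrable_rVZ.
  exact: sq_integrable_rV_cst.
under eq_integral do rewrite -XK.
rewrite integral_enorm_sqr// lee_fin (corr_affine sX s2) (corr_affine sid sT).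
rewrite (corr_same_law mX (@measurable_id _ _ setT) lX sX).
rewrite (corr_same_law m2 mT l2 s2).
rewrite (expect_same_law mX (@measurable_id _ _ setT) lX sX).
rewrite (expect_same_law m2 mT l2 s2).
(* The laws fix every term but the correlation, whose coefficient [- 2 * a] is negative. *)
rewrite !lerD2r lerD2l lerN2 ler_pM2l ?mulr_gt0//.
exact: cT.
Qed.

Let e := expect sigma id.
Let m := expect sigma T.
Let V := corr sigma id id - dotv e e.
Let K := corr sigma id T - dotv e m.

(** Completing the square, first in [b] around [m - a *: e], then in [a] around [K / V]. The last
    term depends on neither. *)
Lemma affine_cost_split (a : R) (b : 'rV[R]_n) : V != 0 ->
  let c := b - (m - a *: e) in
  corr sigma (fun x => a *: x + b - T x) (fun x => a *: x + b - T x) =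
  V * (a - K / V) ^+ 2 + dotv c c +
  (corr sigma T T - dotv m m - K ^+ 2 / V).
Proof.
move=> V0 c; rewrite (corr_affine sid sT).
have bE : b = c + (m - a *: e) by rewrite subrK.
clearbody c; rewrite bE.
rewrite -/e -/m !(dotvDl, dotvDr, dotvNl, dotvNr, dotvZl, dotvZr).
rewrite (dotvC m e) (dotvC m c) (dotvC e c).
have -> : corr sigma id id = V + dotv e e by rewrite subrK.
have -> : corr sigma id T = K + dotv e m by rewrite subrK.
by field.
Qed.

(** The translation is the one that makes the map send the mean [e] to [m]. *)
Definition scal_opt (a : R) : 'rV[R]_n -> 'rV[R]_n :=
  fun x => a *: x + (m - a *: e).

(** Both squares of [affine_cost_split] vanish at exactly one pair, and [0 < K] makes its scaling
    factor admissible in [scal_trans]. *)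
Lemma best_scal_transP (eta : set 'rV[R]_n -> \bar R) S :
  max_corr sigma T ->
  (forall A, measurable A -> pushforward sigma T A = eta A) ->
  0 < V -> 0 < K ->
  best_scal_trans sigma eta S <-> S = scal_opt (K / V).
Proof.
move=> cT etaE V0 K0.
have V0' : V != 0 by rewrite gt_eqF.
have cost a b : 0 < a -> W2 (pushforward sigma (fun x => a *: x + b)) eta =
    sqrte (corr sigma (fun x => a *: x + b - T x) (fun x => a *: x + b - T x))%:E.
  move=> a0; rewrite W2_scal_trans// L2norm_corr//.
  apply: sq_integrable_rVB => //; apply: sq_integrable_rVD.
    exact: sq_integrable_rVZ.
  exact: sq_integrable_rV_cst.
have KV0 : 0 < K / V by rewrite divr_gt0.
split=> [[[a [b [a0 ->]]] Smin]|->].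
  have := Smin (scal_opt (K / V)); rewrite !cost// lee_sqrt ?lee_fin ?corr_ge0//.
  rewrite !affine_cost_split// lerD2r !subrr dotv0l expr0n mulr0 addr0.
  move=> /(_ (ex_intro _ _ (ex_intro _ _ (conj KV0 erefl)))) h.
  have h1 : 0 <= V * (a - K / V) ^+ 2 by rewrite mulr_ge0 ?sqr_ge0// ltW.
  have h2 := dotv_ge0 (b - (m - a *: e)).
  have aE : a = K / V.
    have : V * (a - K / V) ^+ 2 == 0 by rewrite eq_le h1 andbT; lra.
    by rewrite mulf_eq0 (negbTE V0')/= sqrf_eq0 subr_eq0 => /eqP.
  have : b - (m - a *: e) = 0.
    by apply: dotv_eq0; apply/le_anti; rewrite h2 andbT; lra.
  by move/subr0_eq => ->; rewrite /scal_opt aE.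
split=> [|_ [a [b [a0 ->]]]]; first by exists (K / V), (m - (K / V) *: e).
rewrite (cost _ _ KV0) (cost _ _ a0) lee_sqrt ?lee_fin ?corr_ge0//.
rewrite !affine_cost_split// lerD2r !subrr dotv0l expr0n mulr0 addr0 addr_ge0 ?dotv_ge0//.
by rewrite mulr_ge0 ?sqr_ge0// ltW.
Qed.

End ScalTransCost.

(** * Convex potentials *)

Section ConvexGradient.
Context {R : realType} {n : nat} (phi : 'rV[R]_n -> \bar R).
Hypothesis cphi : convex_ereal phi.

Lemma differentiable_ereal_fin_num x :
  differentiable_ereal phi x -> phi x \is a fin_num.
Proof. by case=> + _; exact: nbhs_singleton. Qed.

(** By convexity the difference quotients of [phi] along the segment from [x] to [y] are at most
    [phi y - phi x]; the bound passes to the limit as [t] decreases to 0. The case [phi y = +oo] is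
    immediate. *)
Lemma convex_gradient_le x y : differentiable_ereal phi x ->
  (phi x + ('d (fine \o phi) x (y - x))%:E <= phi y)%E.
Proof.
move=> dx; have fx := differentiable_ereal_fin_num dx.
case: cphi => phiNy conv; case: dx => _ df.
case E : (phi y) => [r| |]; [|by rewrite leey|by have := phiNy y; rewrite E].
set f := fine \o phi; set v := y - x.
have step (t : R) : 0 < t < 1 -> t^-1 *: (f (t *: v + x) - f x) <= r - f x.
  move=> t01; have /andP[t0 t1] := t01.
  have := conv x y t t01.
  have -> : (1 - t) *: x + t *: y = t *: v + x.
    by rewrite /v scalerBr scalerBl scale1r addrC addrA addrAC.
  rewrite E -(fineK fx) -!EFinM -EFinD.
  have := phiNy (t *: v + x); rewrite /f /=; case: (phi _) => [s| |]//= _.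
  rewrite lee_fin => h; rewrite [_ *: _]mulrC ler_pdivrMr//.
  by move: h; rewrite /= -/(f x); nra.
have cv : t^-1 *: (f (t *: v + x) - f x) @[t --> 0^'+] --> 'D_v f x.
  by apply: cvg_dnbhs_at_right; exact: (diff_derivable df).
have : 'D_v f x <= r - f x.
  rewrite -(cvg_lim _ cv)//; apply: limr_le; first exact: cvgP cv.
  near=> t; apply: step; apply/andP; split; near: t.
    exact: nbhs_right_gt.
  exact: nbhs_right_lt.
rewrite deriveE// -(fineK fx) -EFinD lee_fin -lerBrDl.
by [].
Unshelve. all: by end_near.
Qed.

Lemma convex_gradient_le_fine x y : differentiable_ereal phi x ->
  phi y \is a fin_num ->
  fine (phi x) + 'd (fine \o phi) x (y - x) <= fine (phi y).
Proof.
move=> dx fy; rewrite -lee_fin EFinD !fineK//; first exact: convex_gradient_le.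
exact: differentiable_ereal_fin_num.
Qed.

End ConvexGradient.

(** The topology is that of the sup norm, so openness is drawn from the continuity of
    [dotv (y - x) (y - x)], a polynomial in the coordinates of [y]. *)
Lemma open_eball (R : realType) (n : nat) (x : 'rV[R]_n) (r : R) :
  open (eball x r).
Proof.
have [r0|r0] := leP r 0.
  rewrite (_ : eball x r = set0); first exact: open0.
  apply/seteqP; split => // y; rewrite /eball /= => /lt_le_trans-/(_ _ r0).
  by rewrite ltNge sqrtr_ge0.
rewrite (_ : eball x r = (fun y => dotv (y - x) (y - x)) @^-1` [set s | s < r ^+ 2]).
  apply: open_comp; last exact: open_lt.
  move=> y _; rewrite /dotv.
  suff h (s : seq 'I_n) : continuous_at y
      (fun y : 'rV[R]_n => \sum_(i <- s) (y - x) 0 i * (y - x) 0 i) by exact: h.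
  have c i : continuous_at y (fun y : 'rV[R]_n => (y - x) 0 i).
    under eq_fun do rewrite !mxE.
    exact: (cvgB (@coord_continuous R 1 n 0 i y) (cvg_cst (x 0 i))).
  elim: s => [|i s ih].
    have -> : (fun z : 'rV[R]_n => \sum_(i <- [::]) (z - x) 0 i * (z - x) 0 i) =
        (fun=> 0) by apply/funext => z; rewrite big_nil.
    exact: cst_continuous.
  have -> : (fun z : 'rV[R]_n => \sum_(j <- i :: s) (z - x) 0 j * (z - x) 0 j) =
      (fun z => (z - x) 0 i * (z - x) 0 i +
        \sum_(j <- s) (z - x) 0 j * (z - x) 0 j).
    by apply/funext => z; rewrite big_cons.
  exact: (cvgD (cvgM (c i) (c i)) ih).
apply/seteqP; split => y /=; rewrite /eball /= -enorm_sqr.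
  by rewrite ltr_pXn2r// ?nnegrE ?sqrtr_ge0// ltW.
by rewrite ltr_pXn2r// ?nnegrE ?sqrtr_ge0// ltW.
Qed.

(* Monotonicity of the gradient: for almost every [x],
   [T x . (x - E) >= phi x - phi E >= g . (x - E)] with [g] the gradient at the
   mean [E], strictly on the ball, and [g . (x - E)] has zero integral. *)
Lemma potential_corr_gt (R : realType) (n : nat)
    (sigma : probability 'rV[R]_n R) (T : 'rV[R]_n -> 'rV[R]_n)
    (phi : 'rV[R]_n -> \bar R) (x0 : 'rV[R]_n) (r : R) :
  sq_integrable_rV sigma id -> sq_integrable_rV sigma T ->
  convex_ereal phi -> {ae sigma, forall x, has_gradient phi x (T x)} ->
  differentiable_ereal phi (expect sigma id) ->
  msupport sigma x0 -> 0 < r ->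
  (forall lambda : R, 0 < lambda < 1 -> forall y, eball x0 r y ->
    (phi ((1 - lambda) *: y + lambda *: expect sigma id)%R
     < (1 - lambda)%:E * phi y + lambda%:E * phi (expect sigma id))%E) ->
  0 < corr sigma id T - dotv (expect sigma id) (expect sigma T).
Proof.
move=> sid sT cphi gphi dE suppx0 r0 strict.
set E := expect sigma id in dE strict *.
have fE := differentiable_ereal_fin_num dE.
pose g : 'rV[R]_n := \row_i 'd (fine \o phi) E (delta_mx 0 i).
have gE v : 'd (fine \o phi) E v = dotv g v.
  rewrite {1}[v]row_sum_delta linear_sum; apply: eq_bigr => i _.
  by rewrite linearZ mxE mulrC.
pose h x := dotv (T x - g) (x - E).
have sg := sq_integrable_rV_cst sigma g.
have sE := sq_integrable_rV_cst sigma E.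
have sTg := sq_integrable_rVB sT sg.
have sxE := sq_integrable_rVB sid sE.
have ih : sigma.-integrable setT (EFin \o h) by exact: integrable_dotv.
(* Subtracting the constant [g] on one side and the mean [E] on the other leaves the covariance
   unchanged. *)
have hK : corr sigma id T - dotv E (expect sigma T) = (\int[sigma]_x h x)%R.
  rewrite -[RHS]/(corr sigma (fun x => T x - g) (fun x => id x - E)).
  rewrite corrBl// (corrC _ T) (corrC _ (fun=> g)) !corrBl//.
  rewrite !(corrC sigma id (fun=> g)) !corr_cst// expect_cst.
  by rewrite (dotvC E g) subrr subr0.
have aeh : {ae sigma, forall x, 0 <= h x /\ (eball x0 r x -> 0 < h x)}.
  apply: filterS gphi => x [dx gx].
  have fx := differentiable_ereal_fin_num dx.
  have le1 := convex_gradient_le_fine cphi dE fx.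
  have le2 := convex_gradient_le_fine cphi dx fE.
  rewrite gE in le1; rewrite gx in le2.
  have hE : h x = dotv (T x) (x - E) - dotv g (x - E) by rewrite /h dotvDl dotvNl.
  have opp : dotv (T x) (E - x) = - dotv (T x) (x - E) by rewrite -dotvNr opprB.
  rewrite hE; rewrite opp in le2; split; first by lra.
  (* Strictness comes from the midpoint [y]: the gradient inequality at [x] bounds [phi y] from
     below, the hypothesis with [lambda = 2^-1] from above. *)
  move=> Bx; have h01 : 0 < (2^-1 : R) < 1 by rewrite invr_gt0 invf_lt1// ltr0n ltr1n.
  set y := (1 - 2^-1) *: x + 2^-1 *: E.
  have yx : y - x = 2^-1 *: (E - x).
    by apply/rowP => i; rewrite !mxE; lra.
  have lt1 := strict _ h01 x Bx; rewrite -/y in lt1.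
  have fy : phi y \is a fin_num.
    move: lt1; rewrite -(fineK fx) -(fineK fE) -!EFinM -EFinD.
    by have := cphi.1 y; case: (phi y).
  have le3 := convex_gradient_le_fine cphi dx fy.
  rewrite gx yx dotvZr opp in le3.
  move: lt1; rewrite -(fineK fx) -(fineK fE) -(fineK fy) -!EFinM -EFinD lte_fin.
  by lra.
(* If the integral were not positive, [h] would vanish almost everywhere, the ball would be null,
   and [x0] would lie outside the support. *)
rewrite hK ltNge; apply/negP => h0.
have mh : measurable_fun setT (EFin \o h) by exact: measurable_int ih.
have mabs : measurable_fun setT (fun x => `|(EFin \o h) x|%E).
  exact: measurableT_comp.
have abs0 : (\int[sigma]_x `|(EFin \o h) x|)%E = 0%E.
  apply/le_anti/andP; split; last exact: integral_ge0.
  rewrite (ae_eq_integral (EFin \o h))//; last first.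
    by apply: filterS aeh => x [hx _] _; rewrite /= ger0_norm.
  by rewrite -(fineK (integrable_fin_num measurableT ih)) lee_fin; exact: h0.
have /(ae_eq_integral_abs sigma measurableT mh) hae := abs0.
have B0 : {ae sigma, forall x, ~ eball x0 r x}.
  apply: filterS2 aeh hae => x [_ hx] /(_ I) [h0x] /hx.
  by rewrite h0x ltxx.
have oB := @open_eball R n x0 r.
have x0B : eball x0 r x0 by rewrite /eball/= subrr /enorm dotv0l sqrtr0.
have := suppx0 _ (conj oB x0B); rewrite lt_neqAle eq_sym => /andP[/eqP B1 _].
apply: B1; apply/measure0_null_setP.
  exact: sub_sigma_algebra.
apply: negligible_null_set.
have := B0; rewrite /almost_everywhere /=; congr (_.-negligible _).
by apply/seteqP; split => x /=; [move/contrapT|move=> Bx /(_ Bx)].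
Qed.

(** * Maximal correlation *)

Section MaxCorr.
Context {R : realType} {n : nat}.
Variables (sigma : probability 'rV[R]_n R) (T : 'rV[R]_n -> 'rV[R]_n).
Hypothesis mT : measurable_fun setT T.
Hypotheses (sid : sq_integrable_rV sigma id) (sT : sq_integrable_rV sigma T).

Let mid := @measurable_id _ 'rV[R]_n setT.

(** The laws fix both second moments, so the minimal cost, attained by [T], means maximal
    correlation. *)
Lemma max_corr_of_W2 (mu : set 'rV[R]_n -> \bar R) :
  (forall A, measurable A -> pushforward sigma T A = mu A) ->
  L2norm sigma (fun x => x - T x) = W2 sigma mu -> max_corr sigma T.
Proof.
move=> Tmu opt d W P X Y mX mY lX lY.
have sX := sq_integrable_rV_same_law mid mX (same_law_sym lX) sid.
have sY := sq_integrable_rV_same_law mT mY (same_law_sym lY) sT.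
have : (W2 sigma mu <= sqrte (\int[P]_w (enorm (X w - Y w) ^+ 2)%:E))%E.
  apply: (@wasserstein2_le _ _ _ _ _ P X Y mX mY
    (fun x y => enorm (x - y))) => [A mA|A mA|].
  - exact: lX.
  - by rewrite -Tmu//; exact: lY.
  - exact: measurable_enormB.
rewrite -opt L2norm_corr; last exact: (sq_integrable_rVB sid sT).
rewrite integral_enorm_sqr; last exact: sq_integrable_rVB.
rewrite lee_sqrt ?lee_fin ?corr_ge0//.
rewrite corr_diff// (corr_diff sid sT).
rewrite (corr_same_law mX mid lX sX) (corr_same_law mY mT lY sY).
by rewrite !lerD2r lerD2l lerN2 ler_pM2l.
Qed.

(** The squared distance from [a *: X + b] to [Y] is non-negative in mean, and zero when [Y] is that
    very image; the difference is [2 * a] times the gap in correlation. *)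
Lemma max_corr_affine (a : R) (b : 'rV[R]_n) : 0 < a ->
  max_corr sigma (fun x => a *: x + b).
Proof.
move=> a0 d W P X Y mX mY lX lY.
have mS := measurable_scal_trans a b.
have sS : sq_integrable_rV sigma (fun x => a *: x + b).
  apply: sq_integrable_rVD; first exact: sq_integrable_rVZ.
  exact: sq_integrable_rV_cst.
have sX := sq_integrable_rV_same_law mid mX (same_law_sym lX) sid.
have sY := sq_integrable_rV_same_law mS mY (same_law_sym lY) sS.
have := corr_ge0 P (fun w => a *: X w + b - Y w).
have : corr sigma (fun x => a *: x + b - (a *: x + b))
    (fun x => a *: x + b - (a *: x + b)) = 0.
  rewrite /corr; under eq_Rintegral do rewrite subrr dotv0l.
  by rewrite Rintegral_cst// mul0r.
rewrite (corr_affine sid sS) (corr_affine sX sY).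
rewrite (corr_same_law mX mid lX sX) (corr_same_law mY mS lY sY).
rewrite (expect_same_law mX mid lX sX) (expect_same_law mY mS lY sY).
move=> h1 h2; rewrite -(ler_pM2l a0).
by move: h1 h2; set u := corr P X Y; set v := corr sigma id _; lra.
Qed.

Lemma expect_affine (a : R) (b : 'rV[R]_n) :
  expect sigma (fun x => a *: x + b) = a *: expect sigma id + b.
Proof.
have sb := sq_integrable_rV_cst sigma b.
have sS := sq_integrable_rVD (sq_integrable_rVZ a sid) sb.
have key c : dotv c (expect sigma (fun x => a *: x + b)) =
    dotv c (a *: expect sigma id + b).
  have sc := sq_integrable_rV_cst sigma c.
  rewrite -corr_cst// corrC (corrDl (sq_integrable_rVZ a sid) sb sc) corrZl//.
  rewrite (corrC _ id) !corr_cst// expect_cst dotvDr dotvZr.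
  by rewrite (dotvC b c).
by apply/subr0_eq/dotv_eq0; rewrite dotvDr dotvNr key subrr.
Qed.

Lemma mean_pushforward : mean (pushforward sigma T) = expect sigma T.
Proof.
apply/rowP => i; rewrite !mxE; congr fine.
rewrite (@integral_pushforward _ _ _ _ _ T)//.
  by apply/measurable_EFinP; exact: measurable_coord.
exact: sq_integrable_integrable (sT i).
Qed.

(** Cauchy-Schwarz for the centred vectors: the quadratic [quad] in [t] is a squared norm, hence
    never negative. *)
Lemma variance_gt0 : 0 < corr sigma id T - dotv (expect sigma id) (expect sigma T) ->
  0 < corr sigma id id - dotv (expect sigma id) (expect sigma id).
Proof.
set e := expect sigma id; set m := expect sigma T.
set K := _ - dotv e m => K0.
have quad (t : R) : 0 <= t ^+ 2 * (corr sigma id id - dotv e e) - 2 * t * K +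
    (corr sigma T T - dotv m m).
  have := corr_ge0 sigma (fun x => t *: x + (m - t *: e) - T x).
  rewrite (corr_affine sid sT) -/e -/m !(dotvDl, dotvDr, dotvNl, dotvNr, dotvZl, dotvZr).
  by rewrite (dotvC m e) /K; lra.
set V := _ - dotv e e; rewrite ltNge; apply/negP => V0.
set W := _ - dotv m m in quad.
(* If [V <= 0], this value of [t] would make the quadratic at most [-1]. *)
have := quad ((W + 1) / (2 * K)); rewrite -/V.
have -> : 2 * ((W + 1) / (2 * K)) * K = W + 1 by field; rewrite gt_eqF.
by have := sqr_ge0 ((W + 1) / (2 * K)); nra.
Qed.

End MaxCorr.

Lemma integral_dotv_theta (R : realType) (n : nat) (O : 'M[R]_n) d
    (T : measurableType d) (P : probability T R) (Z : T -> 'rV[R]_n) :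
  orthogonal_mx O -> measurable_fun setT Z -> sq_integrable_rV P Z ->
  ((corr P Z Z)%:E =
   \sum_(i < n) \int[P]_w (dotv (Z w) (theta O i) ^+ 2)%:E)%E.
Proof.
move=> oO mZ sZ; rewrite -integral_enorm_sqr// -ge0_integral_sum//.
- by apply: eq_integral => w _; rewrite enorm_sqr (dotv_parseval oO) -sumEFin.
- by move=> i; apply: measurable_sqr_EFin; apply: measurable_dotv.
- by move=> i w _; rewrite lee_fin sqr_ge0.
Qed.

(** * The slice-matching map *)

Section SliceMap.
Context {R : realType} {n : nat}.
Variables (sigma mu : probability 'rV[R]_n R) (O : 'M[R]_n).
Hypotheses (oO : orthogonal_mx O) (ac : sigma `<< @lebesgue_rV R n).
Hypotheses (sid : sq_integrable_rV sigma id) (smu : sq_integrable_rV mu id).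

Let tau i := transport_map_1d (slice sigma (theta O i)) (slice mu (theta O i)).
Let proj i (x : 'rV[R]_n) := dotv x (theta O i).
Let U := slice_map sigma mu O.

Let mproj i : measurable_fun setT (proj i).
Proof. exact: measurable_dotv. Qed.

Let atomless i t : sigma [set x | proj i x = t] = 0%E.
Proof. by apply: ac_hyperplane => //; exact: theta_neq0. Qed.

Let mtau i : measurable_fun setT (tau i).
Proof. exact: (measurable_transport_map_1d sigma mu (mproj i) (mproj i)). Qed.

Let stau i : same_law sigma mu (tau i \o proj i) (proj i).
Proof. exact: (same_law_transport_map_1d mu (mproj i) (mproj i) (atomless i)). Qed.

Lemma proj_slice_map i x : dotv (U x) (theta O i) = tau i (proj i x).
Proof. exact: dotv_sum_theta. Qed.

Lemma measurable_slice_map : measurable_fun setT U.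
Proof.
apply: measurable_rV => i; rewrite /U /slice_map.
rewrite (_ : (fun t => _) =
    (fun x => \sum_j tau j (proj j x) * theta O j 0 i)).
  apply: measurable_sum => j; apply: measurable_funM => //.
  exact: measurableT_comp (mtau j) (mproj j).
by apply/funext => x; rewrite summxE; apply: eq_bigr => j _; rewrite mxE.
Qed.

Lemma same_law_slice_map i :
  same_law sigma mu (fun x => dotv (U x) (theta O i)) (proj i).
Proof.
under [X in same_law _ _ X]eq_fun do rewrite proj_slice_map.
exact: stau.
Qed.

(** Each [tau j] carries a slice of [sigma] to one of [mu], so every component inherits the finite
    second moment of a slice of [mu]. *)
Lemma sq_integrable_slice_map : sq_integrable_rV sigma U.
Proof.
move=> i; rewrite (_ : (fun t => _) =
    (fun x => \sum_j theta O j 0 i * tau j (proj j x))).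
  apply: sq_integrable_sum => j; apply: sq_integrableZ.
  apply: (sq_integrable_same_law (mproj j) _ (same_law_sym (stau j))).
  - exact: measurableT_comp (mtau j) (mproj j).
  - exact: sq_integrable_dotv.
by apply/funext => x; rewrite summxE; apply: eq_bigr => j _; rewrite mxE mulrC.
Qed.

(** The image of [sigma] under [U] may differ from [mu], but their slices along the basis agree, and
    these determine the second moment. *)
Lemma corr_slice_map : corr sigma U U = corr mu id id.
Proof.
apply: EFin_inj; rewrite (integral_dotv_theta oO measurable_slice_map); last first.
  exact: sq_integrable_slice_map.
rewrite (integral_dotv_theta oO _ smu)//; apply: eq_bigr => i _.
rewrite (ge0_integral_same_law _ (mproj i) (same_law_slice_map i)
  (f := fun t => (t ^+ 2)%:E))//.
- exact: (measurable_dotv measurable_slice_map).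
- exact: (measurable_sqr_EFin (@measurable_id _ _ setT)).
- by move=> t; rewrite lee_fin sqr_ge0.
Qed.

(** As for the second moment, the slices along the basis determine the mean. *)
Lemma expect_slice_map : expect sigma U = expect mu id.
Proof.
have E i : dotv (expect sigma U) (theta O i) = dotv (expect mu id) (theta O i).
  rewrite !(dotvC _ (theta O i)) -!corr_cst//; last exact: sq_integrable_slice_map.
  rewrite !(corrC _ (fun=> theta O i)).
  apply: (Rintegral_same_law _ (mproj i) (same_law_slice_map i) (f := id)) => //.
    exact: (measurable_dotv measurable_slice_map).
  by apply: sq_integrable_integrable; apply: sq_integrable_dotv;
    exact: sq_integrable_slice_map.
apply/subr0_eq/dotv_eq0; rewrite (dotv_parseval oO) big1// => i _.
by rewrite dotvDl dotvNl E subrr mul0r.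
Qed.

(* Pythagoras in the basis [theta O] reduces the comparison to the slices,
   where the monotone map is optimal. *)
Lemma corr_le_slice_map d (W : measurableType d) (P : probability W R)
    (X Y : W -> 'rV[R]_n) :
  measurable_fun setT X -> measurable_fun setT Y -> sq_integrable_rV P Y ->
  same_law P sigma X id ->
  (forall i, same_law P mu (fun w => dotv (Y w) (theta O i)) (proj i)) ->
  corr P X Y <= corr sigma id U.
Proof.
move=> mX mY sY lX lY.
have mU := measurable_slice_map; have sU := sq_integrable_slice_map.
have mid := @measurable_id _ 'rV[R]_n setT.
have sX := sq_integrable_rV_same_law mid mX (same_law_sym lX) sid.
have mB d' (W' : measurableType d') (X' Y' : W' -> 'rV[R]_n) :
    measurable_fun setT X' -> measurable_fun setT Y' ->
    measurable_fun setT (fun w => X' w - Y' w).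
  move=> mX' mY'; apply: measurable_rV => i; under eq_fun do rewrite !mxE.
  apply: measurable_funB.
    exact: (measurableT_comp (measurable_coord i) mX').
  exact: (measurableT_comp (measurable_coord i) mY').
(* Second moments only see the slices, on which [Y] and [U] agree in law; comparing correlations
   thus amounts to comparing costs. *)
have YU : corr P Y Y = corr sigma U U.
  rewrite corr_slice_map; apply: EFin_inj.
  rewrite (integral_dotv_theta oO mY)// (integral_dotv_theta oO _ smu)//.
  apply: eq_bigr => i _.
  rewrite (ge0_integral_same_law _ (mproj i) (lY i)
    (f := fun t => (t ^+ 2)%:E))//.
  - exact: measurable_dotv.
  - exact: (measurable_sqr_EFin (@measurable_id _ _ setT)).
  - by move=> t; rewrite lee_fin sqr_ge0.
have : corr sigma (fun x => x - U x) (fun x => x - U x) <=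
    corr P (fun w => X w - Y w) (fun w => X w - Y w).
  rewrite -lee_fin (integral_dotv_theta oO); [|exact: mB|exact: sq_integrable_rVB].
  rewrite (integral_dotv_theta oO); [|exact: mB|exact: sq_integrable_rVB].
  apply: lee_sum => i _.
  under eq_integral do rewrite dotvDl dotvNl proj_slice_map.
  under [leRHS]eq_integral do rewrite dotvDl dotvNl.
  apply: (transport_map_1d_optimal (mproj i) (mproj i) (atomless i)) => //.
  - exact: measurable_dotv.
  - exact: measurable_dotv.
  - exact: (same_law_comp (mproj i) lX).
rewrite (corr_diff sX sY) (corr_diff sid sU) YU (corr_same_law mX mid lX sX).
by rewrite !lerD2r lerD2l lerN2 ler_pM2l.
Qed.

(** A vector with the law of [U] has the slices of [mu] along the basis, so [corr_le_slice_map]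
    applies. *)
Lemma max_corr_slice_map : max_corr sigma U.
Proof.
move=> d W P X Y mX mY lX lY.
have mU := measurable_slice_map.
apply: corr_le_slice_map => // [|i].
  apply: (sq_integrable_rV_same_law mU mY (same_law_sym lY)).
  exact: sq_integrable_slice_map.
exact: (same_law_trans (same_law_comp (mproj i) lY) (same_law_slice_map i)).
Qed.

(** Each slice distance is attained by [tau i], and by Parseval the costs of the slices add up to
    that of [U]. *)
Lemma sum_W2_1d :
  (\sum_(i < n) W2_1d (slice sigma (theta O i)) (slice mu (theta O i)) ^+ 2 =
   (corr sigma (fun x => x - U x) (fun x => x - U x))%:E)%E.
Proof.
have mU := measurable_slice_map; have sU := sq_integrable_slice_map.
rewrite (integral_dotv_theta oO); last 2 first.
- apply: measurable_rV => i; under eq_fun do rewrite !mxE.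
  apply: measurable_funB; first exact: measurable_coord.
  exact: (measurableT_comp (measurable_coord i) mU).
- exact: (sq_integrable_rVB sid sU).
apply: eq_bigr => i _.
under eq_integral do rewrite dotvDl dotvNl proj_slice_map.
set I := (\int[_]_x _)%E.
have I0 : (0 <= I)%E by apply: integral_ge0 => x _; rewrite lee_fin sqr_ge0.
rewrite -(sqr_sqrte I0); congr (_ ^+ 2)%E; apply/le_anti/andP; split.
  have -> : I = (\int[sigma]_x (`|proj i x - tau i (proj i x)| ^+ 2)%:E)%E.
    by apply: eq_integral => x _; rewrite real_normK// num_real.
  apply: (@wasserstein2_le _ _ _ _ _ sigma (proj i) (tau i \o proj i)
    (mproj i) _ (fun x y => `|x - y|)) => //.
  - exact: measurableT_comp (mtau i) (mproj i).
  - exact: stau.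
  - apply: measurableT_comp => //.
    by apply: measurable_funB; [exact: measurable_fst|exact: measurable_snd].
apply: le_wasserstein2 => // p cp.
under eq_integral do rewrite real_normK ?num_real//.
apply: (transport_map_1d_optimal (mproj i) (mproj i) (atomless i)) => //.
- by move=> A mA; have [+ _] := cp A mA.
- by move=> A mA; have [_ +] := cp A mA.
Qed.

End SliceMap.

(** * Distance between the two best maps *)

Theorem proposition5p3 (R : realType) (n : nat)
    (sigma mu : probability 'rV[R]_n R) (P : 'M[R]_n)
    (T : 'rV[R]_n -> 'rV[R]_n) (phi : 'rV[R]_n -> \bar R) :
  W2_space_ac sigma ->
  W2_space mu ->
  orthogonal_mx P ->
  optimal_transport_map sigma mu T ->
  convex_ereal phi ->
  {ae sigma, forall x, has_gradient phi x (T x)} ->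
  differentiable_ereal phi (mean sigma) ->
  (exists (x : 'rV[R]_n) (r : R), [/\ msupport sigma x, 0 < r &
     forall lambda : R, 0 < lambda < 1 ->
       forall y : 'rV[R]_n, eball x r y ->
       (phi ((1 - lambda) *: y + lambda *: mean sigma)%R
        < (1 - lambda)%:E * phi y + lambda%:E * phi (mean sigma))%E]) ->
  let U := slice_push sigma mu P in
  let sumW2 :=
    (\sum_(i < n) W2_1d (slice sigma (theta P i)) (slice mu (theta P i)) ^+ 2)%E
  in
  (exists! S, best_scal_trans sigma mu S) /\
  (exists! S, best_scal_trans sigma U S) /\
  forall S1 S2, best_scal_trans sigma mu S1 -> best_scal_trans sigma U S2 ->
  [/\ W2 (pushforward sigma S1) (pushforward sigma S2)
        = L2norm sigma (fun x => S1 x - S2 x),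
      L2norm sigma (fun x => S1 x - S2 x)
        = ((W2 sigma mu ^+ 2 - sumW2)
           * (2 * Num.sqrt (fine (moment2 sigma) - enorm (mean sigma) ^+ 2))^-1%:E)%E,
      S1 = S2 <-> (W2 sigma mu ^+ 2)%E = sumW2,
      mean (pushforward sigma S1) = mean (pushforward sigma S2)
    & mean (pushforward sigma S2) = mean mu].
Proof.
move=> [s2 ac] mu2 oP [mT Tmu opt] cphi gphi dphi [x0 [r [suppx0 r0 strict]]] U sumW2.
have mid := @measurable_id _ 'rV[R]_n setT.
have sid : sq_integrable_rV sigma id by exact: sq_integrable_rVP s2.
have smu : sq_integrable_rV mu id by exact: sq_integrable_rVP mu2.
have lT : same_law sigma mu T id by exact: Tmu.
have sT : sq_integrable_rV sigma T.
  exact: (sq_integrable_rV_same_law mid mT (same_law_sym lT) smu).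
have sidT := sq_integrable_rVB sid sT.
pose F := slice_map sigma mu P.
have mF : measurable_fun setT F by exact: measurable_slice_map.
have sF : sq_integrable_rV sigma F by exact: sq_integrable_slice_map.
pose e := expect sigma id.
pose V := corr sigma id id - dotv e e.
pose m := expect sigma T.
have mmu : m = expect mu id by exact: (expect_same_law mT mid lT sT).
have mFE : expect sigma F = m by rewrite mmu; exact: expect_slice_map.
pose K1 := corr sigma id T - dotv e m.
pose K2 := corr sigma id F - dotv e m.
have K1_gt0 : 0 < K1 by exact: (potential_corr_gt sid sT cphi gphi dphi suppx0 r0 strict).
have V_gt0 : 0 < V by exact: variance_gt0 K1_gt0.
(* [T] has the law [mu], hence its slices, so it competes with [F] in [corr_le_slice_map]. *)
have K12 : K1 <= K2.
  rewrite lerD2r; apply: (corr_le_slice_map oP ac sid smu mid mT sT) => // i.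
  have mi : measurable_fun setT (fun x : 'rV[R]_n => dotv x (theta P i)).
    exact: measurable_dotv.
  exact: (same_law_comp mi lT).
have K2_gt0 : 0 < K2 by exact: lt_le_trans K12.
have cT : max_corr sigma T by exact: max_corr_of_W2 opt.
have cF : max_corr sigma F by exact: max_corr_slice_map.
(* Both targets have mean [m], so both minimisers lie in this one-parameter family. *)
pose S a : 'rV[R]_n -> 'rV[R]_n := fun x => a *: x + (m - a *: e).
have best1 S' : best_scal_trans sigma mu S' <-> S' = S (K1 / V).
  exact: best_scal_transP.
have best2 S' : best_scal_trans sigma U S' <-> S' = S (K2 / V).
  have := @best_scal_transP _ _ sigma F mF sid sF U S' cF (fun A _ => erefl) V_gt0.
  by rewrite /scal_opt mFE; exact.
have sS a : sq_integrable_rV sigma (S a).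
  by apply: sq_integrable_rVD; [exact: sq_integrable_rVZ|exact: sq_integrable_rV_cst].
have meanS a : mean (pushforward sigma (S a)) = m.
  rewrite mean_pushforward//; last exact: measurable_scal_trans.
  by rewrite expect_affine// subrKC.
have VE : fine (moment2 sigma) - enorm (mean sigma) ^+ 2 = V.
  by rewrite /moment2 (integral_enorm_sqr sid) enorm_sqr.
have ex_uniq (B : set ('rV[R]_n -> 'rV[R]_n)) S0 :
    (forall S', B S' <-> S' = S0) -> exists! S', B S'.
  by move=> BE; exists S0; split=> [|S' /BE]//; apply/BE.
split; first exact: ex_uniq best1.
split; first exact: ex_uniq best2.
move=> _ _ /best1-> /best2->.
(* The two maps agree at [e], so their difference is a multiple of [x - e], whose squared norm is
   [V]. *)
have L2E : L2norm sigma (fun x => S (K1 / V) x - S (K2 / V) x) =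
    ((K2 - K1) / Num.sqrt V)%:E.
  rewrite L2norm_corr; last exact: sq_integrable_rVB.
  have SB x : S (K1 / V) x - S (K2 / V) x = ((K1 - K2) / V) *: (x - e).
    by apply/rowP => i; rewrite !mxE; ring.
  rewrite (_ : (fun x => _) = fun x => ((K1 - K2) / V) *: (x - e)); last exact/funext.
  have se := sq_integrable_rV_cst sigma e.
  have sxe := sq_integrable_rVB sid se.
  rewrite corrZl//; last exact: sq_integrable_rVZ.
  rewrite corrC corrZl// (corr_diff sid se) (corrC sigma id (fun=> e)).
  rewrite !corr_cst// expect_cst.
  have -> : corr sigma id id - 2 * dotv e (expect sigma id) + dotv e e = V.
    by rewrite /V -/e; ring.
  rewrite mulrA -expr2 /sqrte sqrtrM ?sqr_ge0// sqrtr_sqr.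
  rewrite ler0_norm; last by rewrite pmulr_lle0 ?invr_gt0// subr_le0.
  congr (_%:E); rewrite -[X in - (_ / X) * _](sqr_sqrtr (ltW V_gt0)).
  by field; rewrite gt_eqF// sqrtr_gt0.
have W2E : (W2 sigma mu ^+ 2)%E =
    (corr sigma id id - 2 * corr sigma id T + corr sigma T T)%:E.
  rewrite -opt L2norm_corr// sqr_sqrte ?lee_fin ?corr_ge0//.
  by rewrite (corr_diff sid sT).
(* [F] and [T] have the same second moment, so this cost and the previous one differ only in the
   correlation. *)
have sumE : sumW2 = (corr sigma id id - 2 * corr sigma id F + corr sigma T T)%:E.
  rewrite /sumW2 sum_W2_1d// (corr_diff sid sF) /F corr_slice_map//.
  by rewrite (corr_same_law mT mid lT sT).
have cost : L2norm sigma (fun x => S (K1 / V) x - S (K2 / V) x) =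
    ((W2 sigma mu ^+ 2 - sumW2) * (2 * Num.sqrt V)^-1%:E)%E.
  rewrite L2E W2E sumE -EFinB -EFinM; congr (_%:E).
  by rewrite /K1 /K2; field; rewrite gt_eqF// sqrtr_gt0.
split.
(* The target here is the image under the second affine map, which is itself optimal by
   [max_corr_affine]. *)
- apply: W2_scal_trans => //; first exact: measurable_scal_trans.
    by apply: max_corr_affine => //; rewrite divr_gt0.
  by rewrite divr_gt0.
- by rewrite VE.
- split=> [SE|].
    have : L2norm sigma (fun x => S (K1 / V) x - S (K2 / V) x) = 0%E.
      rewrite SE L2norm_corr; last exact: sq_integrable_rVB.
      rewrite /corr; under eq_Rintegral do rewrite subrr dotv0l.
      by rewrite Rintegral_cst// mul0r sqrte0.
    rewrite L2E => -[] /eqP; rewrite mulf_eq0 invr_eq0 sqrtr_eq0 leNgt V_gt0 orbF.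
    rewrite W2E sumE /K1 /K2 => /eqP K; congr (_%:E); lra.
  rewrite W2E sumE => -[] K.
  by have -> : K1 = K2 by rewrite /K1 /K2; lra.
- by rewrite !meanS.
- by rewrite meanS mmu.
Qed.
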